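(* $$\mathscr A_{1,5}=-\frac{9\left[495L(\chi_{-3},6)-30\pi^{2}L(\chi_{-3},4)-2\pi^{4}L(\chi_{-3},2)\right]}{4}.$$
   Context: For real $x>0$ put $\binom{2x}{x}:=\frac{\Gamma(2x+1)}{[\Gamma(x+1)]^2}$, and define $$\mathscr A_{s,n}:=\sum_{k=1}^\infty\left.\frac{\partial^n}{\partial x^n}\frac{1}{x^s\binom{2x}{x}}\right|_{x=k}$$ for integers $s\ge1$, $n\ge0$. Further, $L(\chi_{-3},s):=\sum_{n=0}^\infty\left[(3n+1)^{-s}-(3n+2)^{-s}\right]$. *)

(* Defs.v *)
From mathcomp Require Import all_boot all_order all_algebra.
From mathcomp Require Import all_classical all_reals all_analysis.

Set Implicit Arguments.
Unset Strict Implicit.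
Unset Printing Implicit Defensive.

Import Order.TTheory GRing.Theory Num.Theory.
Import numFieldNormedType.Exports.

Local Open Scope classical_set_scope.
Local Open Scope ring_scope.

(* Euler's integral, meaningful for [0 < x]. *)
Definition Gamma (R : realType) (x : R) : R :=
  \int[lebesgue_measure]_(t in `]0, +oo[) (t `^ (x - 1) * expR (- t)).

Definition central_binom (R : realType) (x : R) : R :=
  Gamma (2 * x + 1) / Gamma (x + 1) ^+ 2.

Definition scrA_term (R : realType) (s n k : nat) : R :=
  derive1n n (fun x : R => (x ^+ s * central_binom x)^-1) k%:R.

Definition scrA_partial (R : realType) (s n N : nat) : R :=
  \sum_(1 <= k < N.+1) scrA_term R s n k.

Definition scrA (R : realType) (s n : nat) : R :=
  limn (scrA_partial R s n).

(* L(chi_{-3}, s), the terms being grouped in pairs. *)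
Definition L_chi3 (R : realType) (s : nat) : R :=
  limn (series (fun n : nat => (3 * n + 1)%:R ^- s - (3 * n + 2)%:R ^- s : R)).

(* Main.v *)
(** We have [1/(x binom(2x,x)) = B(x,x)/2 = 1/2 int_0^1 (t(1-t))^(x-1) dt].
    Differentiating under the integral sign and summing a geometric series,
    [A_{1,5} = 1/2 int_0^1 ln^5(t(1-t)) / (1-t+t^2) dt].

    The measure [dt/(1-t+t^2)] is, up to a constant, the harmonic measure of the
    upper half plane seen from [e^{i pi/3}].  Sending this point to the centre of
    the disc and [0, 1, oo] to the cube roots of unity, [ln t - i pi/3] and
    [ln(1-t) + i pi/3] become differences of the functions
    [log(1 - rho^j z)], while [t in (0,1)] runs through a third of the circle.
    A polynomial in these differences without constant term and invariant under
    [z -> rho z] therefore has mean value zero on that arc, by integrating over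
    the arcs [|z| = r] and letting [r -> 1].  A suitable polynomial of degree 6
    expresses [int ln^5(t(1-t))/(1-t+t^2)] through
    [int ln^n t/(1-t+t^2)] for [n = 1, 3, 5], and these are values of
    [L(chi_{-3}, n+1)] after expansion in powers of [t]. *)

Require Import Defs.
From mathcomp Require Import all_boot all_order all_algebra.
From mathcomp Require Import all_classical all_reals all_analysis.
From mathcomp Require Import measurable_realfun.
From mathcomp Require Import ring lra.

Import Order.TTheory GRing.Theory Num.Theory.
Import numFieldNormedType.Exports.

Local Open Scope classical_set_scope.
Local Open Scope ring_scope.

(** On the arc the two logarithm differences are [a = ln t - i k] and [b = ln (1 - t) + i k] with
    [k = pi / 3] constant, so the real part of a polynomial in [a], [b] is a polynomial in [ln t],
    [ln (1 - t)] and [k]. This is why degree 6 is needed for fifth powers: the degree 6 part carries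
    a factor [i], its leading term is imaginary, and what survives in the real part is [k] times a
    polynomial of degree 5. The obstacle is that the logarithms blow up at both ends of the arc when
    [r = 1]. The mean is therefore shown to vanish for [r < 1] only, and the passage to the limit
    needs a bound uniform in [r], namely a power of [|ln (t (1 - t))|]; that bound is carried along
    through sums and products. Complex numbers are pairs of reals and no contour integral occurs:
    the mean over the arc is differentiated in [r], and the Cauchy-Riemann equations turn the
    derivative into the increment of the imaginary part between the ends of the arc, which the
    invariance cancels. *)

(** * Differentiation *)

(* Hides the class [is_derive], so that applying the lemmas below does not
   trigger instance resolution. *)
Definition der1 {R : realType} (f : R -> R) (x df : R) := is_derive x 1 f df.

Section Der.
Context {R : realType}.
Implicit Types (f g : R -> R) (x c df dg : R).

Lemma der_eq f x df dg : der1 f x df -> df = dg -> is_derive x 1 f dg.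
Proof. by move=> fx <-. Qed.

Lemma der_cst c x : der1 (fun _ : R => c) x 0.
Proof. exact: is_derive_cst. Qed.

Lemma der_id x : der1 (fun t : R => t) x 1.
Proof. exact: is_derive_id. Qed.

Lemma derD f g x df dg : der1 f x df -> der1 g x dg ->
  der1 (fun t => f t + g t) x (df + dg).
Proof. by move=> ? ?; exact: is_deriveD. Qed.

Lemma derN f x df : der1 f x df -> der1 (fun t => - f t) x (- df).
Proof. by move=> ?; exact: is_deriveN. Qed.

Lemma derM f g x df dg : der1 f x df -> der1 g x dg ->
  der1 (fun t => f t * g t) x (f x * dg + g x * df).
Proof. by move=> ? ?; exact: is_deriveM. Qed.

Lemma derV f x df : f x != 0 -> der1 f x df ->
  der1 (fun t => (f t)^-1) x (- (f x) ^- 2 * df).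
Proof. by move=> fx ?; exact: is_deriveV. Qed.

Lemma derX f n x df : der1 f x df ->
  der1 (fun t => f t ^+ n) x (n%:R * f x ^+ n.-1 * df).
Proof.
move=> dfx; rewrite (_ : (fun t => _) = f ^+ n); first exact: is_deriveX.
by apply/funext => t; rewrite exprfctE.
Qed.

Lemma der_comp f g x df dg : der1 f (g x) df -> der1 g x dg ->
  der1 (fun t => f (g t)) x (df * dg).
Proof. by move=> ? ?; exact: (@is_derive1_comp _ f g). Qed.

Lemma der_ln f x df : 0 < f x -> der1 f x df ->
  der1 (fun t => ln (f t)) x ((f x)^-1 * df).
Proof. by move=> fx ?; apply: der_comp => //; exact: is_derive1_ln. Qed.

Lemma der_atan f x df : der1 f x df ->
  der1 (fun t => atan (f t)) x ((1 + f x ^+ 2)^-1 * df).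
Proof. by move=> ?; apply: der_comp => //; exact: is_derive1_atan. Qed.

Lemma der_expR f x df : der1 f x df ->
  der1 (fun t => expR (f t)) x (expR (f x) * df).
Proof. by move=> ?; apply: der_comp => //; exact: is_derive_expR. Qed.

End Der.

(** Unknown functions enter through hypotheses of the context. What is left over are the side
    conditions of [derV] and [der_ln]. *)
Ltac der := first
  [ exact: der_cst | exact: der_id | eassumption
  | apply: derD; der | apply: derN; der | apply: derM; der
  | apply: derX; der | apply: derV; [|der] | apply: der_ln; [|der]
  | apply: der_atan; der | apply: der_expR; der | idtac ].

Section FTC.
Context {R : realType}.
Notation mu := (@lebesgue_measure R).

Lemma is_derive_continuous (f : R -> R) (x df : R) :
  is_derive x 1 f df -> {for x, continuous f}.
Proof.
by move=> [dfx _]; apply: differentiable_continuous; rewrite -derivable1_diffP.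
Qed.

Lemma integral_derive (f F : R -> R) (a b : R) : a < b ->
  (forall x, a <= x <= b -> is_derive x 1 F (f x)) ->
  (forall x, a <= x <= b -> {for x, continuous f}) ->
  (\int[mu]_(x in `[a, b]) (f x)%:E = (F b - F a)%:E)%E.
Proof.
move=> ab dF cf; rewrite EFinB; apply: continuous_FTC2 => //.
- apply/continuous_in_subspaceT => x; rewrite inE /= in_itv /=; exact: cf.
- split.
  + move=> x; rewrite in_itv /= => /andP[ax xb].
    by have [] : is_derive x 1 F (f x) by apply: dF; rewrite !ltW.
  + apply: cvg_at_right_filter; apply: (is_derive_continuous _ _ (f a)).
    by apply: dF; rewrite lexx ltW.
  + apply: cvg_at_left_filter; apply: (is_derive_continuous _ _ (f b)).
    by apply: dF; rewrite lexx ltW.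
- move=> x; rewrite in_itv /= => /andP[ax xb].
  have dFx : is_derive x 1 F (f x) by apply: dF; rewrite !ltW.
  by rewrite derive1E derive_val.
Qed.

End FTC.

(** * Gamma and beta integrals *)

Section Euler.
Context {R : realType}.
Notation mu := (@lebesgue_measure R).
Implicit Types (x y a b t s z : R).

Lemma measurable_affine a b : measurable_fun [set: R] (fun x : R => a * x + b).
Proof. by apply: measurable_funD => //; exact: measurable_funM. Qed.

(** Lebesgue measure is [a] times its image under the affine map, since both agree on half-open
    intervals. Only nonnegativity is asked of [f], because the integrals below are not yet known to
    be finite. *)
Lemma ge0_integral_affine a b (f : R -> \bar R) : 0 < a ->
  measurable_fun [set: R] f -> (forall x, 0 <= f x)%E ->
  (\int[mu]_x f x = a%:E * \int[mu]_x f (a * x + b)%R)%E.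
Proof.
move=> a0 mf f0.
pose phi x : R := a * x + b.
have mphi : measurable_fun setT phi by exact: measurable_affine.
pose k : {nonneg R} := NngNum (ltW a0).
have mphi' : measurable_fun [set: measurableTypeR R]
  (phi : measurableTypeR R -> measurableTypeR R) by exact: mphi.
pose pm : {measure set (measurableTypeR R) -> \bar R} :=
  measure_function_pushforward__canonical__measure_function_Measure mu mphi'.
pose m : {measure set (measurableTypeR R) -> \bar R} := mscale k pm.
have mE : forall A, measurable A -> mu A = m A.
  apply: lebesgue_measure_unique => X [[c d]] /= _ <-.
  have E : phi @^-1` `]c, d]%classic = `](c - b) / a, (d - b) / a]%classic.
    apply/seteqP; split => x /=; rewrite !in_itv /= /phi ltr_pdivrMr// ler_pdivlMr//;
      by rewrite ltrBlDr lerBrDr mulrC.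
  transitivity (a%:E * mu `]((c - b) / a)%R, ((d - b) / a)%R]%classic)%E; last by rewrite -E.
  rewrite !lebesgue_measure_itv /= !lte_fin.
  rewrite ltr_pM2r ?invr_gt0// ltrD2r.
  case: ifPn => // cd; last by rewrite mule0.
  rewrite -!EFinD -EFinM; congr EFin; field; exact: lt0r_neq0.
rewrite (@eq_measure_integral _ _ _ setT m); last first.
  by move=> A mA _; exact: mE.
rewrite ge0_integral_mscale//; congr (_ * _)%E.
by rewrite ge0_integral_pushforward.
Qed.
End Euler.

Section Beta.
Context {R : realType}.
Notation mu := (@lebesgue_measure R).
Implicit Types (x y t s z : R).

(** Extended by zero to the whole line, as is [beta_density], so that the convolution below can be
    treated by Tonelli on the plane without domains of integration. *)
Definition gamma_density x t : R :=
  if 0 < t then t `^ (x - 1) * expR (- t) else 0.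

Definition beta_density x y t : R :=
  if (0 < t) && (t < 1) then t `^ (x - 1) * (1 - t) `^ (y - 1) else 0.

Lemma gamma_density_ge0 x t : 0 <= gamma_density x t.
Proof.
by rewrite /gamma_density; case: ifP => // _; rewrite mulr_ge0 ?powR_ge0 ?expR_ge0.
Qed.

Lemma beta_density_ge0 x y t : 0 <= beta_density x y t.
Proof.
by rewrite /beta_density; case: ifP => // _; rewrite mulr_ge0 ?powR_ge0.
Qed.

Lemma measurable_gamma_density x : measurable_fun [set: R] (gamma_density x).
Proof.
apply: measurable_fun_ifT => //.
- exact: measurable_fun_ltr.
- apply: measurable_funM; first exact: measurable_powR.
  exact: measurableT_comp.
Qed.

Lemma measurable_beta_density x y : measurable_fun [set: R] (beta_density x y).
Proof.
apply: measurable_fun_ifT => //.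
- by apply: measurable_and; exact: measurable_fun_ltr.
- apply: measurable_funM; first exact: measurable_powR.
  apply: (measurableT_comp (measurable_powR _)); exact: measurable_funB.
Qed.

(** The substitution [s = z t] in the convolution, with Jacobian [z]. The [+ 0] is the shape
    produced by [ge0_integral_affine]. *)
Lemma gamma_density_scale x y z t : 0 < z ->
  z * (gamma_density x (z * t + 0) * gamma_density y (z - (z * t + 0))) =
  gamma_density (x + y) z * beta_density x y t.
Proof.
move=> z0; rewrite addr0 /gamma_density /beta_density z0.
rewrite pmulr_rgt0// subr_gt0 gtr_pMr//.
case: ifP => t0 /=; last by rewrite mul0r !mulr0.
case: ifP => t1; last by rewrite !mulr0.
have -> : z - z * t = z * (1 - t) by ring.
rewrite !powRM ?ltW// ?subr_gt0//.
have -> : x + y - 1 = (x - 1) + (y - 1) + 1 by ring.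
have zn : z != 0 by exact: lt0r_neq0.
rewrite (@powRD _ z (x - 1 + (y - 1))); last by rewrite zn implybT.
rewrite (@powRD _ z (x - 1)); last by rewrite zn implybT.
rewrite powRr1 ?ltW//.
have -> : expR (- z) = expR (- (z * t)) * expR (- (z * (1 - t))).
  by rewrite -expRD; congr expR; ring.
ring.
Qed.

Lemma gamma_conv0 x y z s : z <= 0 ->
  gamma_density x s * gamma_density y (z - s) = 0.
Proof.
move=> z0; rewrite /gamma_density; case: ifP => s0; last by rewrite mul0r.
by rewrite ifF ?mulr0//; apply/negbTE; rewrite -leNgt; lra.
Qed.

(** The product is the double integral of a convolution; exchanging the integrals and scaling the
    inner variable by [z] separates the factors. The identity lives in the extended reals, without
    conditions on [x] and [y], so that finiteness can be deduced from it later. *)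
Lemma Euler_beta x y :
  (\int[mu]_t (gamma_density x t)%:E * \int[mu]_t (gamma_density y t)%:E =
   \int[mu]_t (gamma_density (x + y) t)%:E * \int[mu]_t (beta_density x y t)%:E)%E.
Proof.
have gE u : measurable_fun [set: R] (fun t => (gamma_density u t)%:E).
  apply/measurable_EFinP; exact: measurable_gamma_density.
have bE : measurable_fun [set: R] (fun t => (beta_density x y t)%:E).
  apply/measurable_EFinP; exact: measurable_beta_density.
have g0 u t : (0 <= (gamma_density u t)%:E)%E by rewrite lee_fin gamma_density_ge0.
have b0 t : (0 <= (beta_density x y t)%:E)%E by rewrite lee_fin beta_density_ge0.
rewrite -ge0_integralZr; last 4 first.
- exact: measurableT.
- exact: gE.
- by move=> t _; exact: g0.
- by apply: integral_ge0 => t _; exact: g0.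
transitivity (\int[mu]_s \int[mu]_z (gamma_density x s * gamma_density y (z - s))%:E)%E.
  apply: eq_integral => s _.
  rewrite (ge0_integral_affine 1 (- s) _ ltr01 (gE y)) ?mul1e//.
  rewrite -ge0_integralZl; last 4 first.
  - exact: measurableT.
  - exact: (measurableT_comp (gE y) (measurable_affine 1 (- s))).
  - by move=> z _; exact: g0.
  - exact: g0.
  by apply: eq_integral => z _; rewrite EFinM mul1r.
pose F (p : measurableTypeR R * measurableTypeR R) :=
  (gamma_density x p.1 * gamma_density y (p.2 - p.1))%:E.
have mF : measurable_fun setT F.
  apply/measurable_EFinP; apply: measurable_funM.
    exact: (measurableT_comp (measurable_gamma_density x) measurable_fst).
  apply: (measurableT_comp (measurable_gamma_density y)).
  exact: (measurable_funB measurable_snd measurable_fst).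
have F0 p : (0 <= F p)%E by rewrite lee_fin mulr_ge0// gamma_density_ge0.
transitivity (\int[mu]_z \int[mu]_s F (s, z))%E.
  exact: (fubini_tonelli F mF F0).
rewrite -ge0_integralZr; last 4 first.
- exact: measurableT.
- exact: gE.
- by move=> t _; exact: g0.
- by apply: integral_ge0 => t _; exact: b0.
apply: eq_integral => z _.
have [z0|z0] := leP z 0.
  rewrite integral0_eq; last by move=> s _; rewrite /F /= gamma_conv0.
  by rewrite /gamma_density ltNge z0 mul0e.
have mh : measurable_fun [set: R] (fun s => (gamma_density x s * gamma_density y (z - s))%:E).
  apply/measurable_EFinP; apply: measurable_funM; first exact: measurable_gamma_density.
  by apply: (measurableT_comp (measurable_gamma_density y)); exact: measurable_funB.
transitivity (\int[mu]_s (gamma_density x s * gamma_density y (z - s))%:E)%E => //.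
rewrite (ge0_integral_affine z 0 _ z0 mh); last first.
  by move=> s; rewrite lee_fin mulr_ge0// gamma_density_ge0.
rewrite -ge0_integralZl; last 4 first.
- exact: measurableT.
- exact: (measurableT_comp mh (measurable_affine z 0)).
- by move=> s _; rewrite lee_fin mulr_ge0// gamma_density_ge0.
- by rewrite lee_fin ltW.
rewrite -ge0_integralZl; last 4 first.
- exact: measurableT.
- exact: bE.
- by move=> t _; exact: b0.
- exact: g0.
by apply: eq_integral => t _; rewrite -!EFinM gamma_density_scale.
Qed.
End Beta.

Section GammaValues.
Context {R : realType}.
Notation mu := (@lebesgue_measure R).
Implicit Types (x y t s z : R).

Lemma integral_powR01 x : 0 < x ->
  (\int[mu]_(t in `]0%R, 1%R]) (t `^ (x - 1))%:E = (x^-1)%:E)%E.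
Proof.
move=> x0.
(* With [i.+2] the left end is strictly below 1 already for [i = 0], as [integral_derive]
   requires. *)
pose F (i : nat) : set R := `[i.+2%:R^-1, 1]%classic.
have UF : \bigcup_i F i = `]0, 1]%classic.
  apply/seteqP; split => t /=.
    move=> [i _]; rewrite /F /= !in_itv /= => /andP[it ->]; rewrite andbT.
    by apply: lt_le_trans it; rewrite invr_gt0 ltr0n.
  rewrite in_itv /= => /andP[t0 t1].
  exists (Num.bound t^-1) => //; rewrite /F /= in_itv /= t1 andbT.
  rewrite -[leRHS]invrK lef_pV2 ?posrE ?invr_gt0 ?ltr0n//.
  have t0' : 0 < t^-1 by rewrite invr_gt0.
  apply: (le_trans (ltW (archi_boundP (ltW t0')))).
  by rewrite ler_nat -addn2 leq_addr.
have mf : measurable_fun [set: R] (fun t => (t `^ (x - 1))%:E).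
  by apply/measurable_EFinP; exact: measurable_powR.
have cv : (\int[mu]_(t in F i) (t `^ (x - 1))%:E)%E @[i --> \oo] -->
    (\int[mu]_(t in \bigcup_i F i) (t `^ (x - 1))%:E)%E.
  apply: ge0_nondecreasing_set_cvg_integral.
  - move=> i j ij; apply/subsetPset => t; rewrite /F /= !in_itv /= => /andP[it ->].
    rewrite andbT; apply: le_trans it.
    by rewrite lef_pV2 ?posrE ?ltr0n// ler_nat.
  - by move=> i; exact: measurable_itv.
  - by move=> i; exact: measurable_funTS.
  - by move=> i t _; rewrite lee_fin powR_ge0.
rewrite -UF.
suff cv2 : (\int[mu]_(t in F i) (t `^ (x - 1))%:E)%E @[i --> \oo] --> (x^-1)%:E.
  exact: (cvg_unique _ cv cv2).
have E i : (\int[mu]_(t in F i) (t `^ (x - 1))%:E = (x^-1 - x^-1 * (i.+2%:R^-1) `^ x)%:E)%E.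
  have i0 : 0 < i.+2%:R^-1 :> R by rewrite invr_gt0 ltr0n.
  have i1 : i.+2%:R^-1 < 1 :> R by rewrite invf_lt1 ?ltr0n// ltr1n.
  have dF t : i.+2%:R^-1 <= t <= 1 -> is_derive t 1 (fun t => x^-1 * t `^ x) (t `^ (x - 1)).
    move=> /andP[it _]; have t0 : 0 < t by exact: lt_le_trans it.
    have dp := is_derive1_powR x t0.
    apply: der_eq; first der.
    by rewrite mulr0 addr0 mulrA mulVf ?mul1r// gt_eqF.
  have cf t : i.+2%:R^-1 <= t <= 1 -> {for t, continuous (fun t : R => t `^ (x - 1))}.
    move=> /andP[it _]; have t0 : 0 < t by exact: lt_le_trans it.
    by have dp := is_derive1_powR (x - 1) t0; exact: (is_derive_continuous _ _ _ dp).
  by rewrite /F (@integral_derive R _ _ _ _ i1 dF cf) powR1 mulr1.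
rewrite [X in X @ _ --> _](_ : _ =
    fun i => (x^-1 - x^-1 * (i.+2%:R^-1) `^ x)%:E); last first.
  by apply/funext => i; exact: E.
apply: cvg_EFin; first exact: nearW.
have pc : (i.+2%:R^-1 : R) `^ x @[i --> \oo] --> 0.
  have /cvg_at_rightP := powR_cvg0 x0; apply; split.
    by move=> i; rewrite invr_gt0 ltr0n.
  by have := @cvg_harmonic R; rewrite -cvg_shiftS.
rewrite [X in _ --> X](_ : _ = x^-1 - x^-1 * 0); last by rewrite mulr0 subr0.
by apply: cvgB; [exact: cvg_cst|apply: cvgMr].
Qed.

Lemma integral_beta_density1 x : 0 < x ->
  (\int[mu]_t (beta_density x 1 t)%:E = (x^-1)%:E)%E.
Proof.
move=> x0; rewrite -(integral_powR01 _ x0) -integral_itv_bndo_bndc; last first.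
  by apply/measurable_EFinP/measurable_funTS; exact: measurable_powR.
rewrite [RHS]integral_mkcond; apply: eq_integral => t _.
rewrite patchE /beta_density mem_setE in_itv /= subrr powRr0 mulr1.
by case: ifP.
Qed.

Lemma integral_gamma_density1 : (\int[mu]_t (gamma_density (1 : R) t)%:E = 1)%E.
Proof.
transitivity (\int[mu]_(t in `]0%R, +oo[) (expR (- t))%:E)%E.
  rewrite [RHS]integral_mkcond; apply: eq_integral => t _.
  rewrite patchE /gamma_density mem_setE in_itv /= andbT subrr powRr0 mul1r.
  by case: ifP.
rewrite integral_itv_obnd_cbnd; last first.
  by apply/measurable_EFinP/measurable_funTS; exact: measurableT_comp.
rewrite (@ge0_continuous_FTC2y _ _ (fun t => - expR (- t)) 0 0) ?sub0e//.
- by rewrite oppr0 expR0 EFinN oppeK.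
- apply: continuous_subspaceT => t.
  by apply: (continuous_comp (@oppr_continuous _ _ _)); exact: continuous_expR.
- rewrite -oppr0; apply: cvgN; exact: cvgr_expR.
- apply: cvg_at_right_filter; apply: cvgN.
  by apply: (continuous_comp (@oppr_continuous _ _ _)); exact: continuous_expR.
- move=> t _; rewrite derive1E derive_val.
  by rewrite mulrN1 opprK.
Qed.

(** Extended-valued because the functional equation is itself used to prove finiteness for
    [x < 1]. *)
Definition eGamma x : \bar R := (\int[mu]_t (gamma_density x t)%:E)%E.

Lemma eGamma_ge0 x : (0 <= eGamma x)%E.
Proof. by apply: integral_ge0 => t _; rewrite lee_fin gamma_density_ge0. Qed.

(** The case [y = 1] of [Euler_beta], where the beta integral is [1 / x]; this replaces an
    integration by parts. *)
Lemma eGammaS x : 0 < x -> eGamma (x + 1) = (x%:E * eGamma x)%E.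
Proof.
move=> x0; have := Euler_beta x 1.
rewrite integral_beta_density1// integral_gamma_density1 mule1 -/(eGamma _) -/(eGamma _) => ->.
by rewrite muleCA -EFinM mulfV ?mule1// gt_eqF.
Qed.

Lemma eGamma_nat n : eGamma n.+1%:R = (n`!%:R)%:E.
Proof.
elim: n => [|n IH]; first by rewrite /eGamma integral_gamma_density1.
by rewrite -[n.+2]addn1 natrD eGammaS ?ltr0n// IH -EFinM -natrM -factS.
Qed.

(** For [y >= 1] the bound [t^(y-1) <= 1 + t^n] with an integer [n >= y - 1] compares with two
    factorials; the functional equation then reaches [0 < x < 1]. *)
Lemma eGamma_fin x : 0 < x -> (eGamma x < +oo)%E.
Proof.
have ge1 y : 1 <= y -> (eGamma y < +oo)%E.
  move=> y1; have [n yn] : exists n : nat, y <= n.+1%:R.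
    exists (Num.bound y); apply/ltW; apply: lt_le_trans (archi_boundP (le_trans ler01 y1)) _.
    by rewrite ler_nat.
  have : (eGamma y <= eGamma 1 + eGamma n.+1%:R)%E.
    rewrite /eGamma -ge0_integralD//; last 4 first.
    - by move=> t _; rewrite lee_fin gamma_density_ge0.
    - by apply/measurable_EFinP; exact: measurable_gamma_density.
    - by move=> t _; rewrite lee_fin gamma_density_ge0.
    - by apply/measurable_EFinP; exact: measurable_gamma_density.
    apply: ge0_le_integral => //.
    - by move=> t _; rewrite lee_fin gamma_density_ge0.
    - by apply/measurable_EFinP; exact: measurable_gamma_density.
    - by apply/measurable_EFinP; apply: measurable_funD; exact: measurable_gamma_density.
    move=> t _; rewrite -EFinD lee_fin /gamma_density; case: ifP => t0; last by rewrite addr0.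
    rewrite -mulrDl ler_wpM2r ?expR_ge0// subrr powRr0.
    have [t1|t1] := leP t 1.
      apply: (@le_trans _ _ 1); last by rewrite lerDl powR_ge0.
      by rewrite -[leRHS](powRr0 t); apply: ger_powR; rewrite ?t0// subr_ge0.
    apply: (@le_trans _ _ (t `^ (n.+1%:R - 1))); last by rewrite lerDr.
    by apply: ler_powR; [exact: ltW|rewrite lerB].
  move=> /le_lt_trans; apply.
  by rewrite eGamma_nat (eGamma_nat 0) -EFinD ltry.
move=> x0.
have := ge1 (x + 1); rewrite lerDr ltW// eGammaS// => /(_ isT).
by case: (eGamma x) (eGamma_ge0 x) => [r||]//=; rewrite ?ltry// gt0_muley.
Qed.

Lemma eGamma_gt0 x : 1 <= x -> (0 < eGamma x)%E.
Proof.
move=> x1.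
have : (\int[mu]_(t in `[1%R, 2%R]) (expR (- 2))%:E <= eGamma x)%E.
  rewrite /eGamma integral_mkcond; apply: ge0_le_integral => //.
  - by move=> t _; rewrite patchE; case: ifP => // _; rewrite lee_fin expR_ge0.
  - by apply/(measurable_restrictT _ _).1 => //; exact: measurable_cst.
  - by apply/measurable_EFinP; exact: measurable_gamma_density.
  - move=> t _; rewrite patchE; case: ifPn; last by rewrite lee_fin gamma_density_ge0.
    rewrite mem_setE in_itv /= => /andP[t1 t2].
    rewrite lee_fin /gamma_density (lt_le_trans ltr01 t1).
    rewrite -[leLHS]mul1r ler_pM ?expR_ge0 ?ler_expR ?lerN2//.
    by rewrite -[leLHS](powRr0 t); apply: ler_powR; rewrite ?subr_ge0.
apply: lt_le_trans; rewrite integral_cst//= lebesgue_measure_itv /= lte_fin.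
by rewrite ltr1n -EFinD -EFinM lte_fin mulr_gt0 ?expR_gt0//; lra.
Qed.

End GammaValues.

Section GammaBeta.
Context {R : realType}.
Notation mu := (@lebesgue_measure R).
Implicit Types (x y t s z : R).

Lemma Gamma_eGamma x : 0 < x -> (Gamma x)%:E = eGamma x.
Proof.
move=> x0; rewrite /Gamma /Rintegral fineK.
  rewrite integral_mkcond; apply: eq_integral => t _.
  by rewrite patchE /gamma_density mem_setE in_itv /= andbT; case: ifP.
have -> : (\int[mu]_(t in `]0%R, +oo[) (t `^ (x - 1) * expR (- t))%:E = eGamma x)%E.
  rewrite integral_mkcond; apply: eq_integral => t _.
  by rewrite patchE /gamma_density mem_setE in_itv /= andbT; case: ifP.
by rewrite ge0_fin_numE ?eGamma_ge0// eGamma_fin.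
Qed.

Lemma GammaS x : 0 < x -> Gamma (x + 1) = x * Gamma x.
Proof.
move=> x0; have x10 : 0 < x + 1 by rewrite addr_gt0.
by apply: EFin_inj; rewrite EFinM !Gamma_eGamma// eGammaS.
Qed.

Lemma Gamma_gt0 x : 0 < x -> 0 < Gamma x.
Proof.
move=> x0; have x10 : 0 < x + 1 by rewrite addr_gt0.
have : 0 < Gamma (x + 1) by rewrite -lte_fin Gamma_eGamma// eGamma_gt0// lerDr ltW.
by rewrite GammaS// pmulr_rgt0.
Qed.

Lemma integral_beta_density x : 0 < x ->
  (\int[mu]_t (beta_density x x t)%:E = (Gamma x ^+ 2 / Gamma (2 * x))%:E)%E.
Proof.
move=> x0; have x20 : 0 < 2 * x by rewrite mulr_gt0.
have := Euler_beta x x; rewrite -!/(eGamma _) -!Gamma_eGamma//; last by rewrite addr_gt0.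
have -> : x + x = 2 * x by ring.
have G2 := Gamma_gt0 _ x20.
have : (0 <= \int[mu]_t (beta_density x x t)%:E)%E.
  by apply: integral_ge0 => t _; rewrite lee_fin beta_density_ge0.
case: (\int[mu]_t _)%E => [r||]//= _.
  by rewrite -!EFinM => -[E]; congr EFin; rewrite expr2 E mulrAC mulfV ?mul1r// gt_eqF.
by rewrite gt0_muley ?lte_fin.
Qed.

Lemma integrable_powR_onem x : 0 < x ->
  mu.-integrable `]0, 1[ (fun t => ((t * (1 - t)) `^ (x - 1))%:E).
Proof.
move=> x0; apply/integrableP; split.
  apply/measurable_EFinP/measurable_funTS.
  apply: (measurableT_comp (measurable_powR _)); apply: measurable_funM => //.
  exact: measurable_funB.
suff -> : (\int[mu]_(t in `]0%R, 1%R[) `|((t * (1 - t)) `^ (x - 1))%:E| =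
    \int[mu]_t (beta_density x x t)%:E)%E by rewrite integral_beta_density// ltry.
rewrite integral_mkcond; apply: eq_integral => t _.
rewrite patchE /beta_density mem_setE in_itv /=; case: ifP => // /andP[t0 t1].
by rewrite ger0_norm ?powR_ge0// powRM ?subr_ge0 ?ltW.
Qed.

Lemma inv_central_binom x : 0 < x ->
  (x ^+ 1 * central_binom x)^-1 =
  2^-1 * \int[mu]_(t in `]0, 1[) ((t * (1 - t)) `^ (x - 1)).
Proof.
move=> x0; have x20 : 0 < 2 * x by rewrite mulr_gt0.
have -> : \int[mu]_(t in `]0, 1[) ((t * (1 - t)) `^ (x - 1)) = Gamma x ^+ 2 / Gamma (2 * x).
  apply: EFin_inj; rewrite -integral_beta_density// /Rintegral fineK; last first.
    by apply: integrable_fin_num => //; exact: integrable_powR_onem.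
  rewrite integral_mkcond; apply: eq_integral => t _.
  rewrite patchE /beta_density mem_setE in_itv /=; case: ifP => // /andP[t0 t1].
  by rewrite powRM ?subr_ge0 ?ltW.
rewrite /central_binom !GammaS//; field.
by rewrite !gt_eqF// Gamma_gt0.
Qed.

End GammaBeta.

(** * Logarithmic moments *)

Section LogMoment.
Context {R : realType}.
Notation mu := (@lebesgue_measure R).
Implicit Types (x y t u : R) (n : nat).

(** Comes from [1 + z <= exp z] at [z = - e ln u], raised to the power [n]. Only [n e <= y] matters
    for the exponent, and dividing [y] by [n.+1] instead of [n] includes [n = 0]. *)
Lemma ln_powR_bound n u y : 0 < u <= 1 -> 0 < y ->
  `|ln u| ^+ n <= (n.+1%:R / y) ^+ n * u `^ (- y).
Proof.
move=> /[dup] u01 /andP[u0 u1] y0.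
pose e := y / n.+1%:R.
have e0 : 0 < e by rewrite divr_gt0.
have L : `|ln u| = - ln u by rewrite ler0_norm// ln_le0.
have H : `|ln u| <= e^-1 * u `^ (- e).
  rewrite -ler_pdivrMl ?invr_gt0// invrK /powR gt_eqF// L.
  have := expR_ge1Dx (- e * ln u); apply: le_trans; rewrite mulrN mulNr lerDr; lra.
apply: (@le_trans _ _ ((e^-1 * u `^ (- e)) ^+ n)).
  by rewrite lerXn2r// ?nnegrE// mulr_ge0 ?powR_ge0// invr_ge0 ltW.
rewrite exprMn invf_div ler_wpM2l//.
  by rewrite exprn_ge0// divr_ge0// ltW.
rewrite -powR_mulrn ?powR_ge0// -powRrM; apply: ger_powR => //.
rewrite mulNr lerN2 /e mulrAC ler_pdivrMr// ler_pM2l// ler_nat//.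
Qed.

Variables (D : set R) (w : R -> R).
Hypothesis mD : measurable (D : set (measurableTypeR R)).
Hypothesis mw : measurable_fun D w.
Hypothesis w01 : forall t, D t -> 0 < w t <= 1.
Hypothesis iw : forall x, 0 < x -> mu.-integrable D (fun t => (w t `^ (x - 1))%:E).

(** Used with [w t = t * (1 - t)] for the terms of the series and with [w t = t] for the
    L-values. *)
Definition logmoment n x := \int[mu]_(t in D) (ln (w t) ^+ n * w t `^ (x - 1)).

Lemma measurable_logmoment n x :
  measurable_fun D (fun t => ln (w t) ^+ n * w t `^ (x - 1)).
Proof.
apply: measurable_funM; last exact: (measurableT_comp (measurable_powR _) mw).
apply: measurable_funX; exact: (measurableT_comp (@measurable_ln R) mw).
Qed.

(** Half of the exponent pays for the logarithms: they cost a factor [w^(-x/2)], and [w^(x/2 - 1)]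
    is still integrable. *)
Lemma integrable_logmoment n x : 0 < x ->
  mu.-integrable D (fun t => (ln (w t) ^+ n * w t `^ (x - 1))%:E).
Proof.
move=> x0; have x20 : 0 < x / 2 by rewrite divr_gt0.
pose c := (n.+1%:R / (x / 2)) ^+ n.
have i2 := integrableZl mD c (iw _ x20).
apply: (le_integrable mD _ _ i2).
  by apply/measurable_EFinP; exact: measurable_logmoment.
move=> t Dt; have wt := w01 _ Dt; have /andP[w0 w1] := wt.
rewrite -EFinM !abse_EFin lee_fin !normrM normrX [`|w t `^ (x - 1)|]ger0_norm ?powR_ge0//.
rewrite [`|w t `^ (_ - 1)|]ger0_norm ?powR_ge0// [`|c|]ger0_norm; last first.
  by rewrite exprn_ge0// divr_ge0// ltW.
apply: (@le_trans _ _ (c * w t `^ (- (x / 2)) * w t `^ (x - 1))).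
  by rewrite ler_wpM2r ?powR_ge0// ln_powR_bound.
rewrite -mulrA -powRD; last by rewrite (gt_eqF w0) implybT.
by rewrite (_ : - (x / 2) + (x - 1) = x / 2 - 1)//; field.
Qed.

Lemma is_derive_logmoment n x : 0 < x ->
  is_derive x 1 (logmoment n) (logmoment n.+1 x).
Proof.
move=> x0; have x20 : 0 < x / 2 by rewrite divr_gt0.
pose f x t := ln (w t) ^+ n * w t `^ (x - 1).
have df y t : D t -> is_derive y 1 (f^~ t) (ln (w t) ^+ n.+1 * w t `^ (y - 1)).
  move=> Dt; have /andP[w0 w1] := w01 _ Dt.
  have -> : f^~ t = fun y => ln (w t) ^+ n * expR ((y - 1) * ln (w t)).
    by apply/funext => z; rewrite /f /powR gt_eqF.
  apply: der_eq; first der.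
  by rewrite /powR gt_eqF// exprS; ring.
have d1 y t : D t -> partial1of2 f y t = ln (w t) ^+ n.+1 * w t `^ (y - 1).
  by move=> Dt; rewrite partial1of2E; have [_ ->] := df y t Dt.
(* As [w t <= 1], its powers decrease with the exponent, so the value at the left end [x / 2] of the
   neighbourhood dominates throughout. *)
pose G t := `|ln (w t) ^+ n.+1 * w t `^ (x / 2 - 1)|.
have xI : `]x / 2, x + 1[%classic x by rewrite /= in_itv /=; apply/andP; split; lra.
have intf y : `]x / 2, x + 1[%classic y -> mu.-integrable D (EFin \o f y).
  rewrite /= in_itv /= => /andP[xy _].
  exact: (integrable_logmoment n _ (lt_trans x20 xy)).
have derf y t : `]x / 2, x + 1[%classic y -> D t -> derivable (f^~ t) y 1.
  by move=> _ Dt; case: (df y t Dt).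
have G0 t : 0 <= G t by exact: normr_ge0.
have iG : mu.-integrable D (EFin \o G).
  exact: (integrable_norm (integrable_logmoment n.+1 _ x20)).
have Gub y t : `]x / 2, x + 1[%classic y -> D t -> `|partial1of2 f y t| <= G t.
  rewrite /= in_itv /= => /andP[xy _] Dt; rewrite d1// /G !normrM.
  have wt := w01 _ Dt; have /andP[w0 w1] := wt.
  rewrite ler_wpM2l// !ger0_norm ?powR_ge0//.
  by apply: ger_powR => //; rewrite lerB// ltW.
have E := differentiation_under_integral mD xI intf derf G0 iG Gub.
have dv := derivable_under_integral mD xI intf derf G0 iG Gub.
apply: DeriveDef; first exact: dv.
rewrite -derive1E E; apply: eq_Rintegral => t; rewrite inE => Dt.
exact: d1.
Qed.

(** The formula for [g] is available on the positive half-line only; since that set is open,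
    equality near the point is enough at each differentiation. *)
Lemma derive1n_logmoment (g : R -> R) (c : R) n x : 0 < x ->
  (forall x, 0 < x -> g x = c * logmoment 0 x) ->
  derive1n n g x = c * logmoment n x.
Proof.
move=> x0 gE; elim: n x x0 => [|n IH] x x0; first by rewrite /derive1n /= gE.
rewrite /derive1n iterS -/(derive1n n g) derive1E.
have d := is_derive_logmoment n _ x0.
rewrite -(@near_eq_derive _ _ _ (fun x => c * logmoment n x)).
  have : is_derive x 1 (fun x => c * logmoment n x) (c * logmoment n.+1 x).
    by apply: der_eq; [der|rewrite mulr0 addr0].
  by move=> [].
near=> y; rewrite IH//; near: y; exact: lt_nbhsr.
Unshelve. all: by end_near. Qed.

End LogMoment.

(** * Integration over the open unit interval *)

Section UnitInterval.
Context {R : realType}.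
Notation mu := (@lebesgue_measure R).
Implicit Types (t : R) (f g u : R -> R) (n N : nat).

Lemma in01 t : `]0, 1[%classic t <-> 0 < t < 1.
Proof. by rewrite /= in_itv. Qed.

Lemma onem_mul_bound t : 0 < t < 1 -> 0 < t * (1 - t) <= 4^-1.
Proof.
move=> /andP[t0 t1]; apply/andP; split; first by rewrite mulr_gt0 // subr_gt0.
have : 0 <= (t - 2^-1) ^+ 2 by exact: sqr_ge0.
rewrite expr2; lra.
Qed.

Lemma onem_mul_le1 t : `]0, 1[%classic t -> 0 < t * (1 - t) <= 1.
Proof.
by move=> /in01 /onem_mul_bound /andP[-> /le_trans]; apply; lra.
Qed.

Lemma measurable_onem_mul : measurable_fun (`]0, 1[%classic : set R) (fun t : R => t * (1 - t)).
Proof.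
apply: measurable_funTS; apply: measurable_funM => //; exact: measurable_funB.
Qed.

Lemma measurable01 : measurable (`]0, 1[%classic : set (measurableTypeR R)).
Proof. exact: measurable_itv. Qed.

Lemma integrable_le f g : measurable_fun (`]0, 1[%classic : set R) f ->
  mu.-integrable `]0, 1[ (EFin \o g) ->
  (forall t, 0 < t < 1 -> `|f t| <= g t) -> mu.-integrable `]0, 1[ (EFin \o f).
Proof.
move=> mf ig fg; apply: (le_integrable measurable01 _ _ ig).
  by apply/measurable_EFinP; exact: mf.
move=> t /in01 t01; rewrite /= lee_fin; apply: (le_trans (fg _ t01)).
exact: ler_norm.
Qed.

Lemma integrable_scale c f : mu.-integrable `]0, 1[ (EFin \o f) ->
  mu.-integrable `]0, 1[ (EFin \o (fun t => c * f t)).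
Proof. by move=> /(integrableZl measurable01 c). Qed.

Lemma integrable_add f g : mu.-integrable `]0, 1[ (EFin \o f) ->
  mu.-integrable `]0, 1[ (EFin \o g) ->
  mu.-integrable `]0, 1[ (EFin \o (fun t => f t + g t)).
Proof. by move=> fi gi; have := integrableD measurable01 fi gi. Qed.

Lemma integrable_ln_onem_mul n :
  mu.-integrable `]0, 1[ (EFin \o (fun t => `|ln (t * (1 - t))| ^+ n)).
Proof.
have H := integrable_logmoment _ _ measurable01 measurable_onem_mul
  onem_mul_le1 integrable_powR_onem n _ ltr01.
apply: integrable_le (integrable_norm H) _.
  apply: measurable_funX; apply: (measurableT_comp (@normr_measurable R setT)).
  exact: (measurableT_comp (@measurable_ln R) measurable_onem_mul).
by move=> t _; rewrite /= subrr powRr0 mulr1 !normrX normr_id.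
Qed.

Lemma integrable_ln_bound f c n : measurable_fun (`]0, 1[%classic : set R) f ->
  (forall t, 0 < t < 1 -> `|f t| <= c * `|ln (t * (1 - t))| ^+ n) ->
  mu.-integrable `]0, 1[ (EFin \o f).
Proof.
move=> mf; apply: integrable_le mf _.
exact/integrable_scale/integrable_ln_onem_mul.
Qed.

Lemma cvg_Rintegral01 (f_ : nat -> R -> R) f g :
  (forall n, measurable_fun (`]0, 1[%classic : set R) (f_ n)) -> measurable_fun (`]0, 1[%classic : set R) f ->
  mu.-integrable `]0, 1[ (EFin \o g) ->
  (forall n t, 0 < t < 1 -> `|f_ n t| <= g t) ->
  (forall t, 0 < t < 1 -> f_ n t @[n --> \oo] --> f t) ->
  \int[mu]_(t in `]0, 1[) f_ n t @[n --> \oo] --> \int[mu]_(t in `]0, 1[) f t.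
Proof.
move=> mf_ mf ig fg cf.
have m1 n : measurable_fun (`]0, 1[%classic : set (measurableTypeR R)) (fun t => (f_ n t)%:E).
  by apply/measurable_EFinP; exact: mf_.
have m2 : measurable_fun (`]0, 1[%classic : set (measurableTypeR R)) (fun t => (f t)%:E).
  by apply/measurable_EFinP; exact: mf.
have c1 : {ae mu, forall t, `]0, 1[%classic t -> (f_ n t)%:E @[n --> \oo] --> (f t)%:E}.
  apply/aeW => t /in01 t01; apply: cvg_EFin; first exact: nearW.
  exact: cf.
have b1 : {ae mu, forall t n, `]0, 1[%classic t -> (`|(f_ n t)%:E| <= (EFin \o g) t)%E}.
  by apply/aeW => t n /in01 t01; rewrite lee_fin fg.
have [ifi _ cvI] := dominated_convergence measurable01 m1 m2 c1 ig b1.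
apply: fine_cvg; rewrite /Rintegral fineK//.
exact: (integrable_fin_num measurable01 ifi).
Qed.

(** Here [g] stands for the full sum of a geometric series of ratio [u], and [g (1 - u^N)] for its
    partial sum, which is dominated by [|g|] uniformly in [N]. *)
Lemma cvg_Rintegral01_geom g u : measurable_fun (`]0, 1[%classic : set R) g ->
  measurable_fun (`]0, 1[%classic : set R) u -> mu.-integrable `]0, 1[ (EFin \o g) ->
  (forall t, 0 < t < 1 -> 0 <= u t < 1) ->
  \int[mu]_(t in `]0, 1[) (g t * (1 - u t ^+ N)) @[N --> \oo] -->
  \int[mu]_(t in `]0, 1[) g t.
Proof.
move=> mg mu' ig u01.
apply: (cvg_Rintegral01 (fun N t => g t * (1 - u t ^+ N)) g (fun t => `|g t|)) => //.
- move=> N; apply: measurable_funM => //; apply: measurable_funB => //.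
  exact: measurable_funX.
- exact: integrable_norm.
- move=> N t /u01/andP[u0 u1]; rewrite normrM ler_piMr// ger0_norm ?subr_ge0.
    by rewrite gerBl exprn_ge0.
  by rewrite exprn_ile1// ltW.
- move=> t /u01/andP[u0 u1]; rewrite -[X in _ --> X]mulr1.
  apply: cvgMr; rewrite -[X in _ --> X]subr0; apply: cvgB; first exact: cvg_cst.
  by apply: cvg_expr; rewrite ger0_norm.
Qed.

Lemma Rintegral01D f g : mu.-integrable `]0, 1[ (EFin \o f) ->
  mu.-integrable `]0, 1[ (EFin \o g) ->
  \int[mu]_(t in `]0, 1[) (f t + g t) =
  \int[mu]_(t in `]0, 1[) f t + \int[mu]_(t in `]0, 1[) g t.
Proof. by move=> fi gi; exact: (RintegralD measurable01 fi gi). Qed.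

Lemma Rintegral01Z c f : mu.-integrable `]0, 1[ (EFin \o f) ->
  \int[mu]_(t in `]0, 1[) (c * f t) = c * \int[mu]_(t in `]0, 1[) f t.
Proof. by move=> fi; exact: (RintegralZl c measurable01 fi). Qed.

Lemma eq_Rintegral01 f g : (forall t, 0 < t < 1 -> f t = g t) ->
  \int[mu]_(t in `]0, 1[) f t = \int[mu]_(t in `]0, 1[) g t.
Proof. by move=> fg; apply: eq_Rintegral => t; rewrite inE => /in01; exact: fg. Qed.

Lemma Rintegral01_eq0 f : (forall t, 0 < t < 1 -> f t = 0) ->
  \int[mu]_(t in `]0, 1[) f t = 0.
Proof. by move=> f0; rewrite /Rintegral integral0_eq// => t /in01 /f0 ->. Qed.

Lemma integrable_mul f g c : mu.-integrable `]0, 1[ (EFin \o f) ->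
  measurable_fun [set: R] f -> measurable_fun [set: R] g ->
  (forall t, 0 < t < 1 -> `|g t| <= c) ->
  mu.-integrable `]0, 1[ (EFin \o (fun t => f t * g t)).
Proof.
move=> fi mf mg gc.
have mfg : measurable_fun (`]0, 1[%classic : set R) (fun t => f t * g t).
  by apply: measurable_funTS; exact: measurable_funM.
apply: integrable_le mfg (integrable_scale c _ (integrable_norm fi)) _.
by move=> t t01; rewrite normrM mulrC /= ler_wpM2r// gc.
Qed.

Lemma measurable_derivable f df : (forall t, is_derive t 1 f (df t)) ->
  measurable_fun [set: R] f.
Proof.
by move=> fd; apply: continuous_measurable_fun => t; exact: is_derive_continuous.
Qed.

(** Lebesgue measure is its own image under [x -> 1 - x], by comparison on half-open intervals; the
    reflection also fixes the unit interval. *)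
Lemma Rintegral01_onem f : measurable_fun [set: R] f ->
  mu.-integrable `]0, 1[ (EFin \o (fun t => f (1 - t))) ->
  \int[mu]_(t in `]0, 1[) f (1 - t) = \int[mu]_(t in `]0, 1[) f t.
Proof.
move=> mf fi.
pose phi (x : measurableTypeR R) : measurableTypeR R := 1 - x.
have mphi : measurable_fun [set: measurableTypeR R] phi.
  have : measurable_fun [set: R] (fun x : R => 1 - x) by exact: measurable_funB.
  by [].
pose m : {measure set (measurableTypeR R) -> \bar R} :=
  measure_function_pushforward__canonical__measure_function_Measure mu mphi.
have mE : forall A, measurable A -> mu A = m A.
  apply: lebesgue_measure_unique => X [[c d]] /= _ <-.
  have E : phi @^-1` `]c, d]%classic = `[1 - d, 1 - c[%classic.
    by apply/seteqP; split => x /=; rewrite !in_itv /= /phi;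
      move=> /andP[h1 h2]; apply/andP; split; lra.
  rewrite /m /= /pushforward E !lebesgue_measure_itv /= !lte_fin.
  rewrite ltrD2l ltrN2; case: ifPn => // cd.
  by rewrite -!EFinD; congr EFin; ring.
have E01 : phi @^-1` `]0, 1[%classic = `]0, 1[%classic.
  by apply/seteqP; split => x /=; rewrite !in_itv /= /phi;
      move=> /andP[h1 h2]; apply/andP; split; lra.
rewrite /Rintegral; congr fine; apply/esym.
rewrite (@eq_measure_integral _ _ _ _ m); last first.
  by move=> A mA _; exact: mE.
have mf' : measurable_fun [set: measurableTypeR R] (EFin \o f).
  by apply/measurable_EFinP; exact: mf.
have fi' : mu.-integrable (phi @^-1` `]0, 1[%classic) ((EFin \o f) \o phi) by rewrite E01.
by have := integral_pushforward mphi mf' fi' measurable01; rewrite E01.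
Qed.

End UnitInterval.

(** * The series as an integral *)

Section Series.
Context {R : realType}.
Notation mu := (@lebesgue_measure R).
Implicit Types (t x : R) (n N k : nat).

Let w t := t * (1 - t).

Lemma scrA_termE n k : scrA_term R 1 n k.+1 =
  2^-1 * \int[mu]_(t in `]0, 1[) (ln (t * (1 - t)) ^+ n * (t * (1 - t)) ^+ k).
Proof.
have k0 : 0 < k.+1%:R :> R by rewrite ltr0n.
rewrite /scrA_term (derive1n_logmoment _ _ measurable01 measurable_onem_mul
  onem_mul_le1 integrable_powR_onem _ (2^-1) n _ k0).
  congr (_ * _); apply: eq_Rintegral01 => t /onem_mul_bound /andP[w0 _].
  by rewrite -natr1 addrK powR_mulrn// ltW.
move=> x x0; rewrite inv_central_binom//; congr (_ * _).
by apply: eq_Rintegral01 => t _; rewrite expr0 mul1r.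
Qed.

Let w_ge0 t : 0 < 1 - w t.
Proof.
have : 0 <= (t - 2^-1) ^+ 2 by exact: sqr_ge0.
rewrite expr2 /w; lra.
Qed.

Lemma measurable_ln_onem n : measurable_fun [set: R] (fun t => ln (w t) ^+ n).
Proof.
apply: measurable_funX; apply: (measurableT_comp (@measurable_ln R)).
by apply: measurable_funM => //; exact: measurable_funB.
Qed.

Lemma measurable_inv_onem : measurable_fun [set: R] (fun t => (1 - w t)^-1).
Proof.
apply: measurable_derivable => t.
by apply: der_eq; [der; rewrite gt_eqF//; exact: w_ge0|reflexivity].
Qed.

Lemma measurable_onem_exp N : measurable_fun [set: R] (fun t => w t ^+ N).
Proof.
by apply: measurable_funX; apply: measurable_funM => //; exact: measurable_funB.
Qed.

Lemma integrable_ln_onem n : mu.-integrable `]0, 1[ (EFin \o (fun t => ln (w t) ^+ n)).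
Proof.
apply: (integrable_ln_bound _ 1 n); first by apply: measurable_funTS; exact: measurable_ln_onem.
by move=> t _; rewrite mul1r normrX.
Qed.

Lemma integrable_ln_onem_div n :
  mu.-integrable `]0, 1[ (EFin \o (fun t => ln (w t) ^+ n / (1 - w t))).
Proof.
apply: (integrable_mul _ _ (4 / 3) (integrable_ln_onem n)).
- exact: measurable_ln_onem.
- exact: measurable_inv_onem.
- move=> t /onem_mul_bound /andP[w0 w1].
  rewrite ger0_norm; last by rewrite invr_ge0 ltW.
  rewrite (_ : 4 / 3 = (3 / 4)^-1); last by field.
  rewrite lef_pV2 ?posrE ?w_ge0//; rewrite /w; lra.
Qed.

Lemma measurable_ln_onem_div n :
  measurable_fun [set: R] (fun t => ln (w t) ^+ n / (1 - w t)).
Proof.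
apply: measurable_funM; [exact: measurable_ln_onem|exact: measurable_inv_onem].
Qed.

Lemma scrA_partialE n N : scrA_partial R 1 n N =
  2^-1 * \int[mu]_(t in `]0, 1[) (ln (w t) ^+ n / (1 - w t) * (1 - w t ^+ N)).
Proof.
have i1 k : mu.-integrable `]0, 1[ (EFin \o (fun t => ln (w t) ^+ n * w t ^+ k)).
  apply: (integrable_mul _ _ 1 (integrable_ln_onem n)).
  - exact: measurable_ln_onem.
  - exact: measurable_onem_exp.
  - move=> t /in01 /onem_mul_le1 /andP[w0 w1].
    by rewrite normrX exprn_ile1// ger0_norm// ltW.
have i2 k : mu.-integrable `]0, 1[
    (EFin \o (fun t => ln (w t) ^+ n / (1 - w t) * (1 - w t ^+ k))).
  apply: (integrable_mul _ _ 1 (integrable_ln_onem_div n)).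
  - exact: measurable_ln_onem_div.
  - by apply: measurable_funB => //; exact: measurable_onem_exp.
  - move=> t /in01 /onem_mul_le1 /andP[w0 w1].
    have e1 : w t ^+ k <= 1 by rewrite exprn_ile1// ltW.
    by rewrite ger0_norm ?subr_ge0// gerBl exprn_ge0// ltW.
elim: N => [|N IH].
  rewrite /scrA_partial big_geq// (_ : \int[mu]_(t in _) _ = 0) ?mulr0//.
  by apply: Rintegral01_eq0 => t _; rewrite expr0 subrr mulr0.
rewrite /scrA_partial big_nat_recr//= -/(scrA_partial R 1 n N) IH scrA_termE -mulrDr.
congr (_ * _); rewrite -Rintegral01D//.
apply: eq_Rintegral01 => t t01; have w0 := w_ge0 t.
rewrite exprS -/(w t); field.
by rewrite gt_eqF.
Qed.

Lemma cvg_scrA_partial n : scrA_partial R 1 n N @[N --> \oo] -->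
  2^-1 * \int[mu]_(t in `]0, 1[) (ln (t * (1 - t)) ^+ n / (1 - t * (1 - t))).
Proof.
rewrite [X in X @ _ --> _](_ : _ = fun N =>
  2^-1 * \int[mu]_(t in `]0, 1[) (ln (w t) ^+ n / (1 - w t) * (1 - w t ^+ N))); last first.
  by apply/funext => N; exact: scrA_partialE.
apply: cvgMr; apply: (cvg_Rintegral01_geom (fun t => ln (w t) ^+ n / (1 - w t)) w).
- by apply: measurable_funTS; exact: measurable_ln_onem_div.
- exact: measurable_onem_mul.
- exact: integrable_ln_onem_div.
- by move=> t /in01 /onem_mul_le1 /andP[w0 _]; rewrite ltW//= -subr_gt0 w_ge0.
Qed.

End Series.

(** * L-values as integrals *)

Section LogPower.
Context {R : realType}.
Notation mu := (@lebesgue_measure R).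
Implicit Types (t x : R) (n N k m : nat).

Lemma integrable_powR01 x : 0 < x -> mu.-integrable `]0, 1[ (fun t => (t `^ (x - 1))%:E).
Proof.
move=> x0; apply/integrableP; split.
  by apply/measurable_EFinP/measurable_funTS; exact: measurable_powR.
suff -> : (\int[mu]_(t in `]0%R, 1%R[) `|(t `^ (x - 1))%:E| =
    \int[mu]_t (beta_density x 1 t)%:E)%E by rewrite integral_beta_density1// ltry.
rewrite integral_mkcond; apply: eq_integral => t _.
rewrite patchE /beta_density mem_setE in_itv /=; case: ifP => // /andP[t0 t1].
by rewrite ger0_norm ?powR_ge0// subrr powRr0 mulr1.
Qed.

Lemma id_le1 t : `]0, 1[%classic t -> 0 < t <= 1.
Proof. by move=> /in01 /andP[-> /ltW]. Qed.

Lemma measurable_id01 : measurable_fun (`]0, 1[%classic : set R) (fun t => t).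
Proof. exact: measurable_id. Qed.

(** Obtained by differentiating the case [n = 0], which is [1 / x], repeatedly in the exponent. *)
Lemma logmoment_id n x : 0 < x ->
  logmoment `]0, 1[ (fun t => t) n x = (-1) ^+ n * n`!%:R / x ^+ n.+1.
Proof.
elim: n x => [|n IH] x x0.
  rewrite expr0 mul1r expr1 div1r; apply: EFin_inj.
  rewrite -integral_beta_density1// /logmoment /Rintegral fineK; last first.
    apply: (integrable_fin_num measurable01).
    exact: (integrable_logmoment _ _ measurable01 measurable_id01 id_le1 integrable_powR01 0 _ x0).
  rewrite integral_mkcond; apply: eq_integral => t _.
  rewrite patchE /beta_density mem_setE in_itv /=; case: ifP => // /andP[t0 t1].
  by rewrite expr0 mul1r subrr powRr0 mulr1.
have [_ <-] := is_derive_logmoment _ _ measurable01 measurable_id01 id_le1 integrable_powR01 n _ x0.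
rewrite (@near_eq_derive _ _ _ _ (fun x => (-1) ^+ n * n`!%:R * (x ^+ n.+1)^-1)).
  have : is_derive x 1 (fun x => (-1) ^+ n * n`!%:R * (x ^+ n.+1)^-1)
      ((-1) ^+ n.+1 * n.+1`!%:R / x ^+ n.+2).
    apply: der_eq; first by der; rewrite expf_neq0// gt_eqF.
    rewrite factS natrM /= !exprS expr0; field.
    by rewrite expf_neq0 ?gt_eqF.
  by move=> [].
near=> y; rewrite IH//; near: y; exact: lt_nbhsr.
Unshelve. all: by end_near. Qed.

Lemma integrable_ln_pow n m :
  mu.-integrable `]0, 1[ (EFin \o (fun t => ln t ^+ n * t ^+ m)).
Proof.
have m0 : 0 < m.+1%:R :> R by rewrite ltr0n.
have := integrable_logmoment _ _ measurable01 measurable_id01 id_le1 integrable_powR01 n _ m0.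
apply: eq_integrable; first exact: measurable01.
by move=> t; rewrite inE => /in01/andP[t0 _] /=; rewrite -natr1 addrK powR_mulrn// ltW.
Qed.

Lemma Rintegral_ln_pow n m :
  \int[mu]_(t in `]0, 1[) (ln t ^+ n * t ^+ m) =
  (-1) ^+ n * n`!%:R / m.+1%:R ^+ n.+1.
Proof.
have m0 : 0 < m.+1%:R :> R by rewrite ltr0n.
rewrite -logmoment_id//; apply: eq_Rintegral01 => t /andP[t0 _].
by rewrite -natr1 addrK powR_mulrn// ltW.
Qed.

Lemma measurable_ln_expn n : measurable_fun [set: R] (fun t => ln t ^+ n).
Proof. by apply: measurable_funX; exact: measurable_ln. Qed.

End LogPower.

Section Quadratic.
Context {R : realType}.
Implicit Types t : R.

Lemma quadm_ge t : 3 / 4 <= 1 - t + t ^+ 2.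
Proof. by have := sqr_ge0 (t - 2^-1); rewrite !expr2; lra. Qed.

Lemma quadp_ge t : 3 / 4 <= 1 + t + t ^+ 2.
Proof. by have := sqr_ge0 (t + 2^-1); rewrite !expr2; lra. Qed.

Lemma quadm_gt0 t : 0 < 1 - t + t ^+ 2.
Proof. by apply: lt_le_trans (quadm_ge t); lra. Qed.

Lemma quadp_gt0 t : 0 < 1 + t + t ^+ 2.
Proof. by apply: lt_le_trans (quadp_ge t); lra. Qed.

End Quadratic.

Section Lvalues.
Context {R : realType}.
Notation mu := (@lebesgue_measure R).
Implicit Types (t x : R) (n N k m : nat).

Lemma measurable_inv_quadm : measurable_fun [set: R] (fun t => (1 - t + t ^+ 2)^-1).
Proof.
apply: measurable_derivable => t.
by apply: der_eq; [der; rewrite gt_eqF//; exact: quadm_gt0|reflexivity].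
Qed.

Lemma measurable_inv_quadp : measurable_fun [set: R] (fun t => (1 + t + t ^+ 2)^-1).
Proof.
apply: measurable_derivable => t.
by apply: der_eq; [der; rewrite gt_eqF//; exact: quadp_gt0|reflexivity].
Qed.

Lemma inv_Qm_bound t : `|(1 - t + t ^+ 2)^-1| <= 4 / 3.
Proof.
rewrite ger0_norm; last by rewrite invr_ge0 ltW// quadm_gt0.
rewrite (_ : 4 / 3 = (3 / 4)^-1); last by field.
rewrite lef_pV2 ?posrE; [exact: quadm_ge|exact: quadm_gt0|lra].
Qed.

Lemma inv_Qp_bound t : `|(1 + t + t ^+ 2)^-1| <= 4 / 3.
Proof.
rewrite ger0_norm; last by rewrite invr_ge0 ltW// quadp_gt0.
rewrite (_ : 4 / 3 = (3 / 4)^-1); last by field.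
rewrite lef_pV2 ?posrE; [exact: quadp_ge|exact: quadp_gt0|lra].
Qed.

Lemma integrable_ln_exp n : mu.-integrable `]0, 1[ (EFin \o (fun t => ln t ^+ n)).
Proof.
rewrite (_ : (fun t => _) = fun t => ln t ^+ n * t ^+ 0); first exact: integrable_ln_pow.
by apply/funext => t; rewrite expr0 mulr1.
Qed.

(** Expands [K = p / (1 - t^d)] in powers of [t^d], each step contributing one block of terms. It
    serves for [1/(1+t+t^2) = (1-t)/(1-t^3)] and [1/(1-t+t^2) = (1+t)(1-t^3)/(1-t^6)]; both
    denominators are at least [3/4], whence the [4 / 3]. *)
Lemma Rintegral_ln_lim n (K p : R -> R) d (u : nat -> R) :
  measurable_fun [set: R] K -> (forall t, `|K t| <= 4 / 3) ->
  mu.-integrable `]0, 1[ (EFin \o (fun t => ln t ^+ n * p t)) ->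
  (forall m, mu.-integrable `]0, 1[ (EFin \o (fun t => ln t ^+ n * (t ^+ d) ^+ m * p t))) ->
  (forall t, K t * (1 - t ^+ d) = p t) -> (0 < d)%N ->
  (forall m, \int[mu]_(t in `]0, 1[) (ln t ^+ n * (t ^+ d) ^+ m * p t) = u m) ->
  series u @ \oo --> \int[mu]_(t in `]0, 1[) (ln t ^+ n * K t).
Proof.
move=> mK Kb ip ipm Kp d0 uE.
have iK : mu.-integrable `]0, 1[ (EFin \o (fun t => ln t ^+ n * K t)).
  apply: (integrable_mul _ _ (4 / 3) (integrable_ln_exp n)) => //.
  exact: measurable_ln_expn.
have mlK : measurable_fun [set: R] (fun t => ln t ^+ n * K t).
  by apply: measurable_funM => //; exact: measurable_ln_expn.
have te t m : 0 < t < 1 -> 0 <= (t ^+ d) ^+ m <= 1.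
  move=> /andP[/ltW t0 /ltW t1].
  by rewrite exprn_ge0 ?exprn_ge0//= exprn_ile1 ?exprn_ge0 ?exprn_ile1.
have iKm m : mu.-integrable `]0, 1[
    (EFin \o (fun t => ln t ^+ n * K t * (1 - (t ^+ d) ^+ m))).
  apply: (integrable_mul _ _ 1 iK) => //.
  - by apply: measurable_funB => //; do 2 apply: measurable_funX.
  - move=> t /(te _ m) /andP[e0 e1].
    by rewrite ger0_norm ?subr_ge0// gerBl.
have E N : series u N = \int[mu]_(t in `]0, 1[) (ln t ^+ n * K t * (1 - (t ^+ d) ^+ N)).
  elim: N => [|N IH].
    rewrite /series /= big_geq//.
    apply/esym; by apply: Rintegral01_eq0 => t _; rewrite expr0 subrr mulr0.
  rewrite seriesSr IH -uE -Rintegral01D//.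
  by apply: eq_Rintegral01 => t _; rewrite -Kp [_ ^+ N.+1]exprS; ring.
rewrite [X in X @ _ --> _](_ : _ = fun N =>
  \int[mu]_(t in `]0, 1[) (ln t ^+ n * K t * (1 - (t ^+ d) ^+ N))); last first.
  by apply/funext => N; exact: E.
apply: (cvg_Rintegral01_geom (fun t => ln t ^+ n * K t) (fun t => t ^+ d)).
- by apply: measurable_funTS; exact: mlK.
- by apply: measurable_funTS; exact: measurable_funX.
- exact: iK.
- move=> t /andP[t0 t1]; rewrite exprn_ge0 ?ltW//= exprn_ilt1 ?ltW//.
  by rewrite -lt0n.
Qed.

End Lvalues.

Section Lvalues2.
Context {R : realType}.
Notation mu := (@lebesgue_measure R).
Implicit Types (t x : R) (n N k m : nat).

Let chi_term n m : R := (3 * m + 1)%:R ^- n.+1 - (3 * m + 2)%:R ^- n.+1.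

Let c n : R := (-1) ^+ n * n`!%:R.

Lemma cvg_L_chi3_series n :
  series (fun m => c n * chi_term n m) @ \oo -->
  \int[mu]_(t in `]0, 1[) (ln t ^+ n * (1 + t + t ^+ 2)^-1).
Proof.
have iP a : mu.-integrable `]0, 1[ (EFin \o (fun t => (-1) * (ln t ^+ n * t ^+ a))).
  exact/integrable_scale/integrable_ln_pow.
have pE m : (fun t => ln t ^+ n * (t ^+ 3) ^+ m * (1 - t)) =
    (fun t => ln t ^+ n * t ^+ (3 * m) + (-1) * (ln t ^+ n * t ^+ (3 * m).+1)).
  by apply/funext => t; rewrite -exprM exprS; ring.
apply: (Rintegral_ln_lim n _ (fun t => 1 - t) 3).
- exact: measurable_inv_quadp.
- exact: inv_Qp_bound.
- have := integrable_add _ _ (integrable_ln_pow n 0) (iP 1%N).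
  rewrite (_ : (fun t => _) = (fun t => ln t ^+ n * (1 - t)))//.
  by apply/funext => t; rewrite expr0 expr1; ring.
- move=> m; rewrite pE; exact: integrable_add (integrable_ln_pow n _) (iP _).
- move=> t; have q0 : 1 + t + t ^+ 2 != 0 by rewrite gt_eqF// quadp_gt0.
  by field.
- by [].
- move=> m; rewrite pE Rintegral01D//; last exact: integrable_ln_pow.
  rewrite Rintegral01Z; last exact: integrable_ln_pow.
  by rewrite !Rintegral_ln_pow /chi_term /c addn1 addn2; ring.
Qed.

Lemma cvg_eta_series n :
  series (fun m => c n * ((6 * m + 1)%:R ^- n.+1 + (6 * m + 2)%:R ^- n.+1
     - (6 * m + 4)%:R ^- n.+1 - (6 * m + 5)%:R ^- n.+1)) @ \oo -->
  \int[mu]_(t in `]0, 1[) (ln t ^+ n * (1 - t + t ^+ 2)^-1).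
Proof.
have iP a : mu.-integrable `]0, 1[ (EFin \o (fun t => (-1) * (ln t ^+ n * t ^+ a))).
  exact/integrable_scale/integrable_ln_pow.
have i2 a b : mu.-integrable `]0, 1[ (EFin \o (fun t => ln t ^+ n * t ^+ a + ln t ^+ n * t ^+ b)).
  exact: integrable_add (integrable_ln_pow n _) (integrable_ln_pow n _).
have i3 a b d : mu.-integrable `]0, 1[ (EFin \o (fun t => ln t ^+ n * t ^+ a + ln t ^+ n * t ^+ b
    + (-1) * (ln t ^+ n * t ^+ d))).
  exact: integrable_add (i2 _ _) (iP _).
have i4 a b d e : mu.-integrable `]0, 1[ (EFin \o (fun t => ln t ^+ n * t ^+ a + ln t ^+ n * t ^+ b
    + (-1) * (ln t ^+ n * t ^+ d) + (-1) * (ln t ^+ n * t ^+ e))).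
  exact: integrable_add (i3 _ _ _) (iP _).
have pE m : (fun t => ln t ^+ n * (t ^+ 6) ^+ m * (1 + t - t ^+ 3 - t ^+ 4)) =
    (fun t => ln t ^+ n * t ^+ (6 * m) + ln t ^+ n * t ^+ (6 * m + 1)
      + (-1) * (ln t ^+ n * t ^+ (6 * m + 3)) + (-1) * (ln t ^+ n * t ^+ (6 * m + 4))).
  by apply/funext => t; rewrite -exprM !exprD; ring.
apply: (Rintegral_ln_lim n _ (fun t => 1 + t - t ^+ 3 - t ^+ 4) 6).
- exact: measurable_inv_quadm.
- exact: inv_Qm_bound.
- rewrite (_ : (fun t => _) = (fun t => ln t ^+ n * (t ^+ 6) ^+ 0 * (1 + t - t ^+ 3 - t ^+ 4))).
    by rewrite pE.
  by apply/funext => t; rewrite expr0 mulr1.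
- by move=> m; rewrite pE.
- move=> t; have q0 : 1 - t + t ^+ 2 != 0 by rewrite gt_eqF// quadm_gt0.
  by field.
- by [].
- move=> m; rewrite pE !Rintegral01D//; try exact: integrable_ln_pow.
  rewrite !Rintegral01Z; try exact: integrable_ln_pow.
  by rewrite !Rintegral_ln_pow /c -[(6 * m).+1]addn1 -!addnS; ring.
Qed.

(** The sign patterns [+ + - -] and [+ - + -] on the residues 1, 2, 4, 5 modulo 6 differ by twice
    the even terms. These are the terms of the L-series at doubled arguments, hence the factor
    [2 * 2^-(n+1) = 2^-n]. One block of six covers two blocks of three, hence [N + N]. *)
Lemma eta_seriesE n N :
  series (fun m => c n * ((6 * m + 1)%:R ^- n.+1 + (6 * m + 2)%:R ^- n.+1
     - (6 * m + 4)%:R ^- n.+1 - (6 * m + 5)%:R ^- n.+1)) N =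
  series (fun m => c n * chi_term n m) (N + N)%N +
  2 ^- n * series (fun m => c n * chi_term n m) N.
Proof.
elim: N => [|N IH]; first by rewrite /series /= !big_geq// mulr0 addr0.
rewrite addSn addnS !seriesSr IH /chi_term.
have -> : (3 * (N + N) + 1 = 6 * N + 1)%N by ring.
have -> : (3 * (N + N) + 2 = 6 * N + 2)%N by ring.
have -> : (3 * (N + N).+1 + 1 = 6 * N + 4)%N by rewrite -addn1; ring.
have -> : (3 * (N + N).+1 + 2 = 6 * N + 5)%N by rewrite -addn1; ring.
have -> : (6 * N + 2)%:R = 2 * (3 * N + 1)%:R :> R by rewrite -natrM; congr _%:R; ring.
have -> : (6 * N + 4)%:R = 2 * (3 * N + 2)%:R :> R by rewrite -natrM; congr _%:R; ring.
have E (z : R) : (2 * z) ^- n.+1 = 2^-1 * 2 ^- n * z ^- n.+1.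
  by rewrite exprMn invfM exprS invfM.
have aux (S T x1 x5 y1 y2 p k : R) :
    S + p * T + k * (x1 + 2^-1 * p * y1 - 2^-1 * p * y2 - x5) =
    S + k * (x1 - 2^-1 * p * y1) + k * (2^-1 * p * y2 - x5) + p * (T + k * (y1 - y2)).
  by field.
rewrite !E; exact: aux.
Qed.

Lemma Rintegral_ln_quadm n :
  \int[mu]_(t in `]0, 1[) (ln t ^+ n / (1 - t + t ^+ 2)) =
  (-1) ^+ n * n`!%:R * (1 + 2 ^- n) * L_chi3 R n.+1.
Proof.
have c0 : c n != 0 by rewrite mulf_neq0 ?signr_eq0 ?pnatr_eq0 -?lt0n ?fact_gt0.
pose I := \int[mu]_(t in `]0, 1[) (ln t ^+ n * (1 + t + t ^+ 2)^-1).
have cI : series (fun m => c n * chi_term n m) @ \oo --> I by exact: cvg_L_chi3_series.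
have LE : L_chi3 R n.+1 = (c n)^-1 * I.
  apply: cvg_lim => //.
  rewrite (_ : series _ = fun N => (c n)^-1 * series (fun m => c n * chi_term n m) N).
    exact: cvgMr.
  apply/funext => N; rewrite /series /= -mulr_sumr mulrA mulVf// mul1r.
  by apply: eq_bigr.
have -> : (-1) ^+ n * n`!%:R * (1 + 2 ^- n) * L_chi3 R n.+1 = I + 2 ^- n * I.
  have aux (a J p : R) : a != 0 -> a * (1 + p) * (a^-1 * J) = J + p * J.
    by move=> a0; field.
  by rewrite LE; exact: aux.
have := cvg_eta_series n.
rewrite [X in X @ _ --> _](_ : _ = fun N => series (fun m => c n * chi_term n m) (N + N)%N +
  2 ^- n * series (fun m => c n * chi_term n m) N); last first.
  by apply/funext => N; exact: eta_seriesE.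
move=> h; apply: (cvg_unique _ h) => //.
apply: cvgD; last exact: cvgMr.
apply: cvg_comp cI.
move=> A [M _ MA]; exists M => // N /= MN; apply: MA => /=.
exact: leq_trans MN (leq_addr _ _).
Qed.

End Lvalues2.

(** * The mean value property *)

Section Holomorphic.
Context {R : realType}.
Implicit Types (r t x : R) (F G : R -> R -> R * R) (z w : R * R).

(** Pairs stand for complex numbers: calculus is needed only componentwise over the reals, and
    algebraic identities reduce to [ring]. *)
Definition cadd z w : R * R := (z.1 + w.1, z.2 + w.2).
Definition cmul z w : R * R := (z.1 * w.1 - z.2 * w.2, z.1 * w.2 + z.2 * w.1).

(* Speed of the parametrisation of an arc of the unit circle by [t]; up to a
   constant, the harmonic measure of the upper half plane seen from [e^{i pi/3}]. *)
Definition weight t : R := Num.sqrt 3 / (1 - t + t ^+ 2).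

(** A sequence in [[1/2, 1[] tending to 1, since dominated convergence is applied along
    sequences. *)
Definition radius (k : nat) : R := 1 - k.+2%:R^-1.

Definition log_size t : R := `|ln (t * (1 - t))|.

(* [F r t] stands for [f (r e^{i phi(t)})] with [f] holomorphic in the unit disc
   and [phi' = weight]; the witness [D] is [e^{i phi} f'], so that the four
   derivatives are the Cauchy-Riemann equations in polar coordinates.  The last
   two clauses provide the limit [r -> 1] and its domination. *)
Definition hol F := exists D : R -> R -> R * R,
  [/\ forall r t, `|r| < 1 ->
        [/\ der1 (fun r => (F r t).1) r (D r t).1,
            der1 (fun r => (F r t).2) r (D r t).2,
            der1 (fun t => (F r t).1) t (- (r * weight t * (D r t).2)) &
            der1 (fun t => (F r t).2) t (r * weight t * (D r t).1)],
      forall r, `|r| < 1 ->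
        continuous (fun t => (D r t).1) /\ continuous (fun t => (D r t).2),
      forall rho, 0 < rho < 1 -> exists2 M, 0 <= M & forall r t, `|r| <= rho ->
        [/\ `|(F r t).1| <= M, `|(F r t).2| <= M,
            `|(D r t).1| <= M & `|(D r t).2| <= M],
      forall t, 0 < t < 1 ->
        (F (radius k) t).1 @[k --> \oo] --> (F 1 t).1 /\
        (F (radius k) t).2 @[k --> \oo] --> (F 1 t).2 &
      exists c n, 0 <= c /\ forall r t, 0 <= r < 1 -> 0 < t < 1 ->
        `|(F r t).1| <= c * log_size t ^+ n /\ `|(F r t).2| <= c * log_size t ^+ n].

Lemma der1_continuous (f : R -> R) x : (exists d, der1 f x d) -> {for x, continuous f}.
Proof. by move=> [d h]; exact: is_derive_continuous h. Qed.

(** Makes the powers of [log_size] increase with the exponent, so that bounds with different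
    exponents can be merged in [hol_add]. It follows from [t (1 - t) <= (1/2)^2] and
    [ln (1/2) <= - 1/2]. *)
Lemma log_size_ge1 t : 0 < t < 1 -> 1 <= log_size t.
Proof.
move=> /onem_mul_bound /andP[w0 w4]; rewrite /log_size.
have : ln (t * (1 - t)) <= -1.
  have h2 : ln (1 + - 2^-1) <= - 2^-1 :> R by apply: le_ln1Dx; lra.
  have : ln (t * (1 - t)) <= ln ((1 + - 2^-1) ^+ 2).
    by rewrite ler_ln ?posrE//; rewrite expr2; lra.
  by rewrite lnXn; lra.
by move=> h; rewrite ler0_norm; lra.
Qed.

Lemma hol_cst z : hol (fun _ _ => z).
Proof.
exists (fun _ _ => (0, 0)); split => /=.
- move=> r t _; rewrite !mulr0 oppr0; split; exact: der_cst.
- by move=> r _; split; exact: cst_continuous.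
- move=> rho _; exists (`|z.1| + `|z.2|); first by rewrite addr_ge0.
  by move=> r t _; rewrite normr0 lerDl lerDr !normr_ge0 addr_ge0.
- by move=> t _; split; exact: cvg_cst.
- exists (`|z.1| + `|z.2|), 0%N; split; first by rewrite addr_ge0.
  by move=> r t _ _; rewrite expr0 mulr1 lerDl lerDr !normr_ge0.
Qed.

Lemma hol_add F G : hol F -> hol G -> hol (fun r t => cadd (F r t) (G r t)).
Proof.
move=> [D [dF cF bF lF [c [n [c0 sF]]]]] [E [dG cG bG lG [d [m [d0 sG]]]]].
exists (fun r t => cadd (D r t) (E r t)); split => /=.
- move=> r t r1; have [f1 f2 f3 f4] := dF r t r1; have [g1 g2 g3 g4] := dG r t r1.
  split; apply: der_eq; (try by apply: derD; eassumption) => //=; ring.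
- move=> r r1; have [f1 f2] := cF r r1; have [g1 g2] := cG r r1.
  by split => t; apply: cvgD; [exact: f1|exact: g1|exact: f2|exact: g2].
- move=> rho rho1; have [M M0 hM] := bF rho rho1; have [M' M0' hM'] := bG rho rho1.
  exists (M + M'); first exact: addr_ge0.
  move=> r t r1; have [f1 f2 f3 f4] := hM r t r1; have [g1 g2 g3 g4] := hM' r t r1.
  by split; apply: (le_trans (ler_normD _ _)); exact: lerD.
- move=> t t01; have [f1 f2] := lF t t01; have [g1 g2] := lG t t01.
  by split; exact: cvgD.
- exists (c + d), (n + m)%N; split; first exact: addr_ge0.
  move=> r t r1 t01; have [f1 f2] := sF r t r1 t01; have [g1 g2] := sG r t r1 t01.
  have l1 := log_size_ge1 t t01.
  have h : c * log_size t ^+ n + d * log_size t ^+ m <= (c + d) * log_size t ^+ (n + m).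
    rewrite mulrDl; apply: lerD; apply: ler_wpM2l => //; apply: ler_weXn2l => //.
      exact: leq_addr.
    exact: leq_addl.
  by split; apply: (le_trans (ler_normD _ _)); apply: le_trans h; exact: lerD.
Qed.

Lemma hol_mul F G : hol F -> hol G -> hol (fun r t => cmul (F r t) (G r t)).
Proof.
move=> [D [dF cF bF lF [c [n [c0 sF]]]]] [E [dG cG bG lG [d [m [d0 sG]]]]].
exists (fun r t => cadd (cmul (D r t) (G r t)) (cmul (F r t) (E r t))); split => /=.
- move=> r t r1; have [f1 f2 f3 f4] := dF r t r1; have [g1 g2 g3 g4] := dG r t r1.
  split; (apply: der_eq; [apply: derD; [|try apply: derN]; apply: derM; eassumption|rewrite /=; ring]).
- move=> r r1; have [f1 f2] := cF r r1; have [g1 g2] := cG r r1.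
  have cF1 t : {for t, continuous (fun t => (F r t).1)}.
    by have [_ _ h _] := dF r t r1; exact: is_derive_continuous h.
  have cF2 t : {for t, continuous (fun t => (F r t).2)}.
    by have [_ _ _ h] := dF r t r1; exact: is_derive_continuous h.
  have cG1 t : {for t, continuous (fun t => (G r t).1)}.
    by have [_ _ h _] := dG r t r1; exact: is_derive_continuous h.
  have cG2 t : {for t, continuous (fun t => (G r t).2)}.
    by have [_ _ _ h] := dG r t r1; exact: is_derive_continuous h.
  split => t.
    apply: cvgD; apply: cvgB; apply: cvgM;
    [exact: f1|exact: cG1|exact: f2|exact: cG2|exact: cF1|exact: g1|exact: cF2|exact: g2].
  apply: cvgD; apply: cvgD; apply: cvgM;
    [exact: f1|exact: cG2|exact: f2|exact: cG1|exact: cF1|exact: g2|exact: cF2|exact: g1].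
- move=> rho rho1; have [M M0 hM] := bF rho rho1; have [M' M0' hM'] := bG rho rho1.
  exists (4 * (M * M')); first by rewrite !mulr_ge0.
  move=> r t r1; have [f1 f2 f3 f4] := hM r t r1; have [g1 g2 g3 g4] := hM' r t r1.
  have h a b : `|a| <= M -> `|b| <= M' -> `|a * b| <= M * M'.
    by move=> ha hb; rewrite normrM ler_pM.
  have MM : 0 <= M * M' by rewrite mulr_ge0.
  have h2 a b a' b' : `|a| <= M -> `|b| <= M' -> `|a'| <= M -> `|b'| <= M' ->
    `|a * b + a' * b'| <= 2 * (M * M').
    by move=> ? ? ? ?; apply: (le_trans (ler_normD _ _)); rewrite mulr2n mulrDl mul1r lerD ?h.
  have h3 a b a' b' : `|a| <= M -> `|b| <= M' -> `|a'| <= M -> `|b'| <= M' ->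
    `|a * b - a' * b'| <= 2 * (M * M').
    by move=> ? ? ? ?; rewrite -mulNr; apply: h2; rewrite ?normrN.
  have h4 a b : `|a| <= 2 * (M * M') -> `|b| <= 2 * (M * M') -> `|a + b| <= 4 * (M * M').
    by move=> ? ?; apply: (le_trans (ler_normD _ _)); lra.
  split.
  + by apply: (le_trans (h3 _ _ _ _ f1 g1 f2 g2)); lra.
  + by apply: (le_trans (h2 _ _ _ _ f1 g2 f2 g1)); lra.
  + by apply: h4; exact: h3.
  + by apply: h4; exact: h2.
- move=> t t01; have [f1 f2] := lF t t01; have [g1 g2] := lG t t01.
  by split; [apply: cvgB|apply: cvgD]; exact: cvgM.
- exists (2 * (c * d)), (n + m)%N; split; first by rewrite !mulr_ge0.
  move=> r t r1 t01; have [f1 f2] := sF r t r1 t01; have [g1 g2] := sG r t r1 t01.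
  have l0 : 0 <= log_size t by rewrite (le_trans ler01)// log_size_ge1.
  have h a b : `|a| <= c * log_size t ^+ n -> `|b| <= d * log_size t ^+ m ->
      `|a * b| <= c * d * log_size t ^+ (n + m).
    by move=> ha hb; rewrite normrM exprD mulrACA ler_pM.
  have E2 : 2 * (c * d) * log_size t ^+ (n + m) =
    c * d * log_size t ^+ (n + m) + c * d * log_size t ^+ (n + m) by ring.
  rewrite E2; split.
    by apply: (le_trans (ler_normB _ _)); apply: lerD; exact: h.
  by apply: (le_trans (ler_normD _ _)); apply: lerD; exact: h.
Qed.

End Holomorphic.

(** * The logarithm of [1 - r z] for [z] on the unit circle *)

Section LogFactor.
Context {R : realType}.
Implicit Types (r t x : R).
Variables C S : R -> R.
Hypothesis dC : forall t, is_derive t 1 C (- (weight t * S t)).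
Hypothesis dS : forall t, is_derive t 1 S (weight t * C t).
Hypothesis CS : forall t, C t ^+ 2 + S t ^+ 2 = 1.
(** Controls how fast [z] may approach 1 at the ends of the arc, that is, how fast the logarithm may
    blow up. The constant suits all three points below, where [1 - C] is [3/2] times [t^2], [1] or
    [(1-t)^2] divided by [1 - t + t^2 <= 1]. *)
Hypothesis lowC : forall t, 0 < t < 1 -> 3 / 2 * (t * (1 - t)) ^+ 2 <= 1 - C t.

(* [log (1 - r z)] for [z = C + i S] on the unit circle. *)
Definition clog r t : R * R :=
  (2^-1 * ln (1 - 2 * r * C t + r ^+ 2), - atan (r * S t / (1 - r * C t))).

Let N r t := 1 - 2 * r * C t + r ^+ 2.

Lemma norm_cos_le1 t : `|C t| <= 1.
Proof.
rewrite -(@ler_pXn2r _ 2) ?nnegrE// expr1n real_normK ?num_real//.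
by rewrite -(CS t) lerDl sqr_ge0.
Qed.

Lemma norm_sin_le1 t : `|S t| <= 1.
Proof.
rewrite -(@ler_pXn2r _ 2) ?nnegrE// expr1n real_normK ?num_real//.
by rewrite -(CS t) lerDr sqr_ge0.
Qed.

Lemma onem_rC r t : 1 - `|r| <= 1 - r * C t.
Proof.
rewrite lerD2l lerN2; apply: (le_trans (ler_norm _)); rewrite normrM.
by rewrite ler_piMr// norm_cos_le1.
Qed.

Lemma normE r t : N r t = (1 - r * C t) ^+ 2 + (r * S t) ^+ 2.
Proof.
have -> : (1 - r * C t) ^+ 2 + (r * S t) ^+ 2 = 1 - 2 * r * C t + r ^+ 2 * (C t ^+ 2 + S t ^+ 2) by ring.
by rewrite CS mulr1.
Qed.

Lemma norm_gt0 r t : 0 < 1 - r * C t -> 0 < N r t.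
Proof. by move=> h; rewrite normE ltr_pwDl ?sqr_ge0// exprn_gt0. Qed.

(** The derivative is [- z / (1 - r z) = (r - z) / N], because [|z| = 1]. The condition on [1 - r C]
    admits [r = 1] away from [z = 1], which gives the radial limits. *)
Lemma der_clog_r r t : 0 < 1 - r * C t ->
  der1 (fun r => (clog r t).1) r ((r - C t) / N r t) /\
  der1 (fun r => (clog r t).2) r (- S t / N r t).
Proof.
move=> h; have N0 := norm_gt0 _ _ h.
have n0 : N r t != 0 by rewrite gt_eqF.
have h0 : 1 - r * C t != 0 by rewrite gt_eqF.
split.
  apply: der_eq; first by der; exact: N0.
  by rewrite /= -/(N r t); field.
apply: der_eq; first by der; exact: h0.
have E : 1 + (r * S t / (1 - r * C t)) ^+ 2 = N r t / (1 - r * C t) ^+ 2.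
  by rewrite normE; field.
by rewrite E; field; rewrite ?h0 ?n0.
Qed.

Lemma der_clog_t r t : 0 < 1 - r * C t ->
  der1 (fun t => (clog r t).1) t (- (r * weight t * (- S t / N r t))) /\
  der1 (fun t => (clog r t).2) t (r * weight t * ((r - C t) / N r t)).
Proof.
move=> h; have N0 := norm_gt0 _ _ h.
have n0 : N r t != 0 by rewrite gt_eqF.
have h0 : 1 - r * C t != 0 by rewrite gt_eqF.
have dCt := dC t; have dSt := dS t.
split.
  apply: der_eq; first by der; exact: N0.
  by rewrite /= -/(N r t); field.
apply: der_eq; first by der; exact: h0.
have E : 1 + (r * S t / (1 - r * C t)) ^+ 2 = N r t / (1 - r * C t) ^+ 2.
  by rewrite normE; field.
rewrite E.
have -> : r - C t = r * (C t ^+ 2 + S t ^+ 2) - C t by rewrite CS mulr1.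
by field; rewrite ?h0 ?n0.
Qed.

Lemma ln_norm_bound (a x : R) : 0 < a -> a <= x -> x <= 4 -> `|ln x| <= 4 + a^-1.
Proof.
move=> a0 ax x4; have x0 : 0 < x by exact: lt_le_trans ax.
have h1 := ln_sublinear x0.
have h2 : ln x^-1 < x^-1 by apply: ln_sublinear; rewrite invr_gt0.
have h3 : x^-1 <= a^-1 by rewrite lef_pV2 ?posrE.
rewrite lnV ?posrE// in h2.
have a1 : 0 < a^-1 by rewrite invr_gt0.
rewrite ler_norml; apply/andP; split; lra.
Qed.

Lemma norm_le4 r t : `|r| <= 1 -> N r t <= 4.
Proof.
move=> r1; have c1 := norm_cos_le1 t.
have h : `|r * C t| <= 1 by rewrite normrM -[leRHS]mulr1 ler_pM.
have h2 : r ^+ 2 <= 1 by rewrite -(real_normK (num_real r)) expr_le1.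
have := ler_norm (- (r * C t)); rewrite normrN /N; lra.
Qed.

(** A bound uniform in [r], as domination for [r -> 1] requires. For [C >= 0] the difference of the
    two sides is [(r - C)^2 + (1 - C)(1/2 + C)]; for [C < 0] already [N >= 1]. *)
Lemma norm_ge r t : 0 <= r -> (1 - C t) / 2 <= N r t.
Proof.
move=> r0; have c1 := norm_cos_le1 t.
have [c0|c0] := leP 0 (C t).
  have : 0 <= (r - C t) ^+ 2 by exact: sqr_ge0.
  have cb : C t <= 1 by apply: le_trans c1; exact: ler_norm.
  have : 0 <= (1 - C t) * (2^-1 + C t) by rewrite mulr_ge0//; lra.
  rewrite /N !expr2; lra.
have c2 : - 1 <= C t by move: c1; rewrite ler_norml => /andP[].
have : 0 <= r * - C t by rewrite mulr_ge0// oppr_ge0 ltW.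
have : 0 <= r ^+ 2 by exact: sqr_ge0.
rewrite /N; lra.
Qed.

Lemma norm_atan_le2 x : `|atan x| <= 2.
Proof.
have h1 := atan_gtNpi2 x; have h2 := atan_ltpi2 x; have h3 := @pihalf_lt2 R.
rewrite ler_norml; apply/andP; split; lra.
Qed.

Lemma hol_clog : hol clog.
Proof.
have pos r t : `|r| < 1 -> 0 < 1 - r * C t.
  by move=> r1; apply: lt_le_trans (onem_rC r t); rewrite subr_gt0.
exists (fun r t => ((r - C t) / N r t, - S t / N r t)); split => /=.
- move=> r t r1; have [h1 h2] := der_clog_r r t (pos _ t r1).
  by have [h3 h4] := der_clog_t r t (pos _ t r1).
- move=> r r1.
  have n0 t : N r t != 0 by rewrite gt_eqF// norm_gt0// pos.
  split => t; have dCt := dC t; have dSt := dS t.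
    by apply: der1_continuous; eexists; rewrite /N; der; exact: n0.
  by apply: der1_continuous; eexists; rewrite /N; der; exact: n0.
- move=> rho /andP[rho0 rho1].
  pose a := (1 - rho) ^+ 2.
  have a0 : 0 < a by rewrite exprn_gt0// subr_gt0.
  exists (2 * (4 + a^-1)); first by rewrite mulr_ge0// addr_ge0// invr_ge0 ltW.
  move=> r t rr.
  have r1 : `|r| < 1 by exact: le_lt_trans rho1.
  have aN : a <= N r t.
    rewrite normE; apply: (@le_trans _ _ ((1 - r * C t) ^+ 2)); last by rewrite lerDl sqr_ge0.
    have p1 : 0 <= 1 - rho by lra.
    have p2 : 0 <= 1 - r * C t by apply: ltW; exact: pos.
    have p3 : 1 - rho <= 1 - r * C t.
      by apply: le_trans (onem_rC r t); rewrite lerD2l lerN2.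
    by rewrite /a lerXn2r ?nnegrE.
  have N0 : 0 < N r t by exact: lt_le_trans aN.
  have iN : (N r t)^-1 <= a^-1 by rewrite lef_pV2 ?posrE.
  have i0 : 0 < (N r t)^-1 by rewrite invr_gt0.
  have a1 : 0 < a^-1 by rewrite invr_gt0.
  have c1 := norm_cos_le1 t; have s1 := norm_sin_le1 t.
  split.
  + rewrite normrM ger0_norm ?invr_ge0//.
    have := ln_norm_bound _ _ a0 aN (norm_le4 _ _ (ltW r1)); rewrite -/(N r t); lra.
  + rewrite normrN; have := norm_atan_le2 (r * S t / (1 - r * C t)); lra.
  + rewrite normrM (ger0_norm (ltW i0)).
    have h : `|r - C t| <= 2 by apply: (le_trans (ler_normB _ _)); lra.
    apply: (@le_trans _ _ (2 * a^-1)); last by lra.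
    by apply: ler_pM => //; exact: ltW.
  + rewrite normrM (ger0_norm (ltW i0)) normrN.
    apply: (@le_trans _ _ (1 * a^-1)); last by lra.
    by apply: ler_pM => //; exact: ltW.
- move=> t t01.
  have c1 : 0 < 1 - 1 * C t.
    rewrite mul1r; apply: lt_le_trans (lowC t t01).
    have /andP[w0 _] := onem_mul_bound t t01.
    by rewrite mulr_gt0 ?exprn_gt0//; lra.
  have cr : radius k @[k --> \oo] --> (1 : R).
    rewrite /radius -[X in _ --> X]subr0; apply: cvgB; first exact: cvg_cst.
    by have := @cvg_harmonic R; rewrite -cvg_shiftS.
  have [h1 h2] := der_clog_r 1 t c1.
  have k1 := is_derive_continuous _ _ _ h1.
  have k2 := is_derive_continuous _ _ _ h2.
  split.
    exact: (cvg_comp (@radius R) (fun r => (clog r t).1) cr k1).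
  exact: (cvg_comp (@radius R) (fun r => (clog r t).2) cr k2).
(* With [w = t (1 - t)] one has [w^4 <= N <= 1/w], so [|ln N| <= 4 log_size], and the factor [1/2]
   in [clog] leaves 2. The arctangent is at most 2, and [log_size >= 1]. *)
- exists 2, 1%N; split => // r t /andP[r0 r1] t01.
  have /andP[w0 w4] := onem_mul_bound t t01.
  have l1 := log_size_ge1 t t01; rewrite expr1.
  have ln0 : ln (t * (1 - t)) <= 0 by apply: ln_le0; lra.
  have lE : log_size t = - ln (t * (1 - t)) by rewrite /log_size ler0_norm.
  split; last by rewrite normrN; have := norm_atan_le2 (r * S t / (1 - r * C t)); lra.
  rewrite normrM ger0_norm ?invr_ge0// -/(N r t).
  have hN : (t * (1 - t)) ^+ 4 <= N r t.
    apply: le_trans (norm_ge r t r0); have := lowC t t01.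
    set w := t * (1 - t) in w0 w4 *.
    have w2 : w ^+ 2 <= 16^-1.
      have : 0 <= (4^-1 - w) * (4^-1 + w) by rewrite mulr_ge0//; lra.
      by rewrite expr2; lra.
    have w20 : 0 <= w ^+ 2 by exact: sqr_ge0.
    have : w ^+ 2 * w ^+ 2 <= 16^-1 * w ^+ 2 by rewrite ler_wpM2r.
    rewrite -exprD; lra.
  have w40 : 0 < (t * (1 - t)) ^+ 4 by exact: exprn_gt0.
  have N0 : 0 < N r t by exact: lt_le_trans hN.
  have lnN1 : 4 * ln (t * (1 - t)) <= ln (N r t).
    by rewrite mulr_natl -lnXn// ler_ln ?posrE.
  have lnN2 : ln (N r t) <= - ln (t * (1 - t)).
    rewrite -lnV ?posrE// ler_ln ?posrE ?invr_gt0//.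
    apply: (le_trans (norm_le4 r t _)); first by rewrite ger0_norm// ltW.
    by rewrite -[leLHS]invrK lef_pV2 ?posrE.
  have : `|ln (N r t)| <= 4 * log_size t by rewrite ler_norml lE; apply/andP; split; lra.
  lra.
Qed.

End LogFactor.

(** * The mean over one arc *)

Section MeanValue.
Context {R : realType}.
Notation mu := (@lebesgue_measure R).
Implicit Types (r t x : R) (F : R -> R -> R * R).

Lemma weight_ge0 t : 0 <= weight t.
Proof.
by rewrite /weight divr_ge0 ?sqrtr_ge0 ?ltW ?quadm_gt0.
Qed.

Lemma weight_le4 t : weight t <= 4.
Proof.
rewrite /weight ler_pdivrMr; last by exact: quadm_gt0.
apply: (@le_trans _ _ 2); last by have := quadm_ge t; lra.
have -> : 2 = Num.sqrt (2 ^+ 2) :> R by rewrite sqrtr_sqr ger0_norm.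
by rewrite ler_wsqrtr// expr2; lra.
Qed.

Lemma continuous_weight : continuous (@weight R).
Proof.
move=> t; apply: der1_continuous; eexists; rewrite /weight; der.
by rewrite gt_eqF//; exact: quadm_gt0.
Qed.

Lemma measurable_weight : measurable_fun [set: R] (@weight R).
Proof. exact: continuous_measurable_fun continuous_weight. Qed.

Lemma integrable_cst01 c : mu.-integrable `]0, 1[ (EFin \o (fun=> c)).
Proof.
apply: (integrable_ln_bound _ `|c| 0) => // t _.
by rewrite expr0 mulr1.
Qed.

Lemma integrable_bounded (f : R -> R) M : measurable_fun [set: R] f ->
  (forall t, 0 < t < 1 -> `|f t| <= M) -> mu.-integrable `]0, 1[ (EFin \o f).
Proof.
move=> mf fM; apply: integrable_le (integrable_cst01 M) fM.
exact: measurable_funTS.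
Qed.

Lemma Rintegral01_derive (f F : R -> R) :
  (forall t, 0 <= t <= 1 -> is_derive t 1 F (f t)) -> continuous f ->
  \int[mu]_(t in `]0, 1[) f t = F 1 - F 0.
Proof.
move=> dF cf.
have mf : measurable_fun [set: R] f by exact: continuous_measurable_fun.
have E := integral_derive f F 0 1 ltr01 dF (fun t _ => cf t).
have m1 (D : set (measurableTypeR R)) : measurable_fun D (fun t => (f t)%:E).
  by apply/measurable_EFinP; apply: measurable_funTS; exact: mf.
have E2 : (\int[mu]_(x in `]0%R, 1%R[) (f x)%:E = \int[mu]_(x in `[0%R, 1%R]) (f x)%:E)%E.
  rewrite integral_itv_bndo_bndc; last exact: m1.
  by rewrite integral_itv_obnd_cbnd//; exact: m1.
by rewrite /Rintegral E2 E.
Qed.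

(* The derivative in [r] of the integral is [1/r] times the increment of
   [(F r t).2] along the arc. *)
Lemma hol_mean F : hol F ->
  (forall r, 0 < r < 1 -> (F r 1).2 = (F r 0).2) ->
  (forall t, (F 0 t).1 = 0) ->
  mu.-integrable `]0, 1[ (EFin \o (fun t => (F 1 t).1 * weight t)) /\
  \int[mu]_(t in `]0, 1[) ((F 1 t).1 * weight t) = 0.
Proof.
move=> [D [dF cD bF lF [c [n [c0 sF]]]]] F01 F00.
have mF r : `|r| < 1 -> measurable_fun [set: R] (fun t => (F r t).1 * weight t).
  move=> r1; apply: measurable_funM; last exact: measurable_weight.
  apply: measurable_derivable => t; have [_ _ h _] := dF r t r1; exact: h.
pose K r := \int[mu]_(t in `]0, 1[) ((F r t).1 * weight t).
have bW a M t : `|a| <= M -> `|a * weight t| <= M * 4.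
  by move=> aM; rewrite normrM ler_pM// ger0_norm ?weight_ge0// weight_le4.
have dK r : `|r| < 1 ->
    is_derive r 1 K (\int[mu]_(t in `]0, 1[) ((D r t).1 * weight t)).
  move=> r1; pose rho := (1 + `|r|) / 2.
  have rr : `|r| < rho by rewrite /rho; lra.
  have rho1 : 0 < rho < 1 by have := normr_ge0 r; rewrite /rho; lra.
  have [M M0 hM] := bF rho rho1.
  have I1 x : `]- rho, rho[%classic x -> `|x| < rho.
    by rewrite /= in_itv /= ltr_norml.
  have I2 x : `]- rho, rho[%classic x -> `|x| < 1.
    by move=> /I1 /lt_trans; apply; case/andP: rho1.
  have Ir : `]- rho, rho[%classic r by rewrite /= in_itv /= -ltr_norml.
  pose f x t := (F x t).1 * weight t.
  have intf x : `]- rho, rho[%classic x -> mu.-integrable `]0, 1[ (EFin \o f x).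
    move=> Ix; apply: (integrable_bounded _ (M * 4)); first exact: mF (I2 _ Ix).
    by move=> t _; apply: bW; have [] := hM x t (ltW (I1 _ Ix)).
  have df x t : `]- rho, rho[%classic x -> is_derive x 1 (f ^~ t) ((D x t).1 * weight t).
    move=> Ix; have [h _ _ _] := dF x t (I2 _ Ix).
    by apply: der_eq; [rewrite /f; der|rewrite /=; ring].
  have d1 x t : `]- rho, rho[%classic x -> partial1of2 f x t = (D x t).1 * weight t.
    by move=> Ix; rewrite partial1of2E; have [_ ->] := df x t Ix.
  have derf x t : `]- rho, rho[%classic x -> `]0, 1[%classic t -> derivable (f ^~ t) x 1.
    by move=> Ix _; case: (df x t Ix).
  have G0 (t : R) : 0 <= M * 4 by rewrite mulr_ge0.
  have Gub x t : `]- rho, rho[%classic x -> `]0, 1[%classic t -> `|partial1of2 f x t| <= M * 4.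
    by move=> Ix _; rewrite d1//; apply: bW; have [] := hM x t (ltW (I1 _ Ix)).
  have E := differentiation_under_integral measurable01 Ir intf derf G0 (integrable_cst01 (M * 4)) Gub.
  have dv := derivable_under_integral measurable01 Ir intf derf G0 (integrable_cst01 (M * 4)) Gub.
  apply: DeriveDef; first exact: dv.
  rewrite -derive1E E; apply: eq_Rintegral01 => t _.
  exact: d1.
have dK0 r : 0 < r < 1 -> \int[mu]_(t in `]0, 1[) ((D r t).1 * weight t) = 0.
  move=> r01; have /andP[r0 r1] := r01.
  have rn : `|r| < 1 by rewrite ger0_norm// ltW.
  have cf : continuous (fun t => r * weight t * (D r t).1).
    have [h _] := cD r rn => t; apply: cvgM; last exact: h.
    apply: cvgM; [exact: cvg_cst|exact: continuous_weight].
  have := Rintegral01_derive (fun t => r * weight t * (D r t).1) (fun t => (F r t).2) _ cf.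
  rewrite F01// subrr.
  have iD : mu.-integrable `]0, 1[ (EFin \o (fun t => (D r t).1 * weight t)).
    have [M M0 hM] := bF r r01.
    apply: (integrable_bounded _ (M * 4)).
      apply: measurable_funM; last exact: measurable_weight.
      by have [h _] := cD r rn; exact: continuous_measurable_fun.
    have rr : `|r| <= r by rewrite ger0_norm// ltW.
    by move=> t _; apply: bW; have [] := hM r t rr.
  rewrite (eq_Rintegral01 _ (fun t => r * ((D r t).1 * weight t))); last by move=> t _; ring.
  rewrite Rintegral01Z// => /(_ _)/eqP; rewrite mulf_eq0 (gt_eqF r0) /= => h.
  apply/eqP/h => t _; have [_ _ _ h4] := dF r t rn; exact: h4.
(* By the mean value theorem [K r = K 0 = 0]. Negative radii are allowed in [hol], so [K] is
   differentiable, hence continuous, at 0 as well. *)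
have K0 r : 0 <= r < 1 -> K r = 0.
  move=> /andP[]; rewrite le_eqVlt => /predU1P[<- _|r0 r1].
    by apply: Rintegral01_eq0 => t _; rewrite F00 mul0r.
  have lt1 x : 0 <= x <= r -> `|x| < 1.
    by move=> /andP[x0 xr]; rewrite ger0_norm//; exact: le_lt_trans r1.
  have dKx x : x \in `]0, r[%R -> is_derive x 1 K (\int[mu]_(t in `]0, 1[) ((D x t).1 * weight t)).
    rewrite in_itv /= => /andP[x0 xr]; apply: dK; apply: lt1; lra.
  have cK : {within `[0, r], continuous K}.
    apply/continuous_in_subspaceT => x; rewrite inE /= in_itv /= => xr.
    exact: is_derive_continuous (dK x (lt1 x xr)).
  have [y yr E] := @MVT R K (fun x => \int[mu]_(t in `]0, 1[) ((D x t).1 * weight t)) 0 r r0 dKx cK.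
  move: yr; rewrite in_itv /= => /andP[y0 yr].
  move: E; rewrite dK0; last by rewrite y0 (lt_trans yr).
  rewrite mul0r => /eqP; rewrite subr_eq0 => /eqP ->.
  by apply: Rintegral01_eq0 => t _; rewrite F00 mul0r.
have rad k : 0 <= (radius k : R) < 1.
  rewrite /radius; apply/andP; split; last by rewrite gtrBl invr_gt0 ltr0n.
  by rewrite subr_ge0 invf_le1 ?ltr0n// ler1n.
have radn k : `|radius k : R| < 1.
  by have /andP[h1 h2] := rad k; rewrite ger0_norm.
have lcv t : 0 < t < 1 ->
    ((F (radius k) t).1 * weight t) @[k --> \oo] --> (F 1 t).1 * weight t.
  by move=> t01; apply: cvgMl; have [] := lF t t01.
have mF1 : measurable_fun (`]0, 1[%classic : set R) (fun t => (F 1 t).1 * weight t).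
  apply: (measurable_fun_cvg (h := fun k t => (F (radius k) t).1 * weight t)).
  - by move=> k; apply: measurable_funTS; apply: mF.
  - by move=> t /in01; exact: lcv.
have b1 r t : 0 <= r < 1 -> 0 < t < 1 -> `|(F r t).1 * weight t| <= c * 4 * log_size t ^+ n.
  move=> r01 t01; have [h _] := sF r t r01 t01.
  by rewrite mulrAC; exact: bW.
have iG : mu.-integrable `]0, 1[ (EFin \o (fun t => c * 4 * log_size t ^+ n)).
  exact/integrable_scale/integrable_ln_onem_mul.
split.
  (* The bound in [hol] concerns [r < 1]; at [r = 1] it is inherited through the limit. *)
  apply: integrable_le mF1 iG _ => t t01.
  have h := lcv t t01.
  have h' : `|(F (radius k) t).1 * weight t| @[k --> \oo] --> `|(F 1 t).1 * weight t|.
    exact: cvg_norm.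
  rewrite -(cvg_lim (@Rhausdorff R) h'); apply: limr_le.
    by apply/cvg_ex; eexists; exact: h'.
  by apply: nearW => k; exact: b1.
have cv : K (radius k) @[k --> \oo] --> \int[mu]_(t in `]0, 1[) ((F 1 t).1 * weight t).
  apply: (cvg_Rintegral01 (fun k t => (F (radius k) t).1 * weight t) _ (fun t => c * 4 * log_size t ^+ n)) => //.
  - by move=> k; apply: measurable_funTS; apply: mF.
  - by move=> k t; exact: b1.
suff cv0 : K (radius k) @[k --> \oo] --> (0 : R) by exact: (cvg_unique _ cv cv0).
rewrite [X in X @ _ --> _](_ : _ = fun=> 0); first exact: cvg_cst.
by apply/funext => k; exact: K0.
Qed.

End MeanValue.

(** * The three points on the circle *)

Section ThreePoints.
Context {R : realType}.
Implicit Types (r t x k p q : R).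

Notation Q t := (1 - t + t ^+ 2).
Notation sq3 := (Num.sqrt 3 : R).

Let Q_gt0 t : 0 < Q t.
Proof. exact: quadm_gt0. Qed.

Let sq3_sqr : sq3 ^+ 2 = 3.
Proof. by rewrite sqr_sqrtr. Qed.

Definition on_circle (C S : R -> R) :=
  [/\ forall t, is_derive t 1 C (- (weight t * S t)),
      forall t, is_derive t 1 S (weight t * C t),
      forall t, C t ^+ 2 + S t ^+ 2 = 1 &
      forall t, 0 < t < 1 -> 3 / 2 * (t * (1 - t)) ^+ 2 <= 1 - C t].

(** Clears denominators: [2 t - 1] is the derivative of [Q], and the square roots of 3 in [weight]
    and in the sine combine, so that everything becomes a polynomial condition. *)
Lemma on_circle_poly (A B A' B' : R -> R) :
  (forall t, der1 A t (A' t)) -> (forall t, der1 B t (B' t)) ->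
  (forall t, B' t * Q t - B t * (2 * t - 1) = - 3 * A t) ->
  (forall t, A' t * Q t - A t * (2 * t - 1) = B t) ->
  (forall t, B t ^+ 2 + 3 * A t ^+ 2 = 4 * Q t ^+ 2) ->
  (forall t, 0 < t < 1 -> 3 * (t * (1 - t)) ^+ 2 <= 2 * Q t - B t) ->
  on_circle (fun t => B t / (2 * Q t)) (fun t => sq3 * A t / (2 * Q t)).
Proof.
move=> dA dB h1 h2 h3 h4.
have q0 t : Q t != 0 by rewrite gt_eqF.
have q20 t : 2 * Q t != 0 by rewrite mulf_neq0.
split.
- move=> t; have dAt := dA t; have dBt := dB t.
  apply: der_eq; first by der; exact: q20.
  transitivity ((B' t * Q t - B t * (2 * t - 1)) / (2 * Q t ^+ 2)); first by field; exact: q0.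
  rewrite h1 /weight.
  transitivity (- (sq3 ^+ 2 * A t / (2 * Q t ^+ 2))); last by field; exact: q0.
  by rewrite sq3_sqr; field; exact: q0.
- move=> t; have dAt := dA t; have dBt := dB t.
  apply: der_eq; first by der; exact: q20.
  transitivity (sq3 * (A' t * Q t - A t * (2 * t - 1)) / (2 * Q t ^+ 2)); first by field; exact: q0.
  by rewrite h2 /weight; field; exact: q0.
- move=> t.
  transitivity ((B t ^+ 2 + sq3 ^+ 2 * A t ^+ 2) / (4 * Q t ^+ 2)); first by field; exact: q0.
  by rewrite sq3_sqr h3; field; exact: q0.
- move=> t t01; have := h4 t t01; have Qt := Q_gt0 t.
  have Q1 : Q t <= 1 by case/andP: t01 => t0 t1; have : 0 <= t * (1 - t); [rewrite mulr_ge0//; lra|rewrite expr2; lra].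
  rewrite (_ : 1 - B t / (2 * Q t) = (2 * Q t - B t) / (2 * Q t)); last by field; exact: q0.
  rewrite ler_pdivlMr; last by lra.
  have : 0 <= (t * (1 - t)) ^+ 2 by exact: sqr_ge0.
  set w2 := (_ ^+ 2) => w20 h.
  have : w2 * Q t <= w2 by rewrite ler_piMr.
  lra.
Qed.

(* [z_j = C_j + i S_j] with [z_0 = (t - w) / (1 - w t)], up to rotation, for
   [w = e^{i pi/3}], and [z_1], [z_2] its rotations by [2 pi/3] and [4 pi/3];
   they equal [1] at [t = 0], [t = oo] and [t = 1] respectively. *)
Definition C0 t : R := (2 - 2 * t - t ^+ 2) / (2 * Q t).
Definition S0 t : R := sq3 * (t * (2 - t)) / (2 * Q t).
Definition C1 t : R := (2 * t ^+ 2 - 2 * t - 1) / (2 * Q t).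
Definition S1 t : R := sq3 * (1 - 2 * t) / (2 * Q t).
Definition C2 t : R := (4 * t - 1 - t ^+ 2) / (2 * Q t).
Definition S2 t : R := sq3 * (t ^+ 2 - 1) / (2 * Q t).

Let w_le t : 0 < t < 1 -> (t * (1 - t)) ^+ 2 <= t ^+ 2 /\
  (t * (1 - t)) ^+ 2 <= 1 /\ (t * (1 - t)) ^+ 2 <= (1 - t) ^+ 2.
Proof.
move=> /andP[t0 t1]; have u0 : 0 < 1 - t by lra.
have t2 : 0 <= t ^+ 2 <= 1 by rewrite exprn_ge0 ?exprn_ile1//; lra.
have u2 : 0 <= (1 - t) ^+ 2 <= 1 by rewrite exprn_ge0 ?exprn_ile1//; lra.
move: t2 u2 => /andP[a b] /andP[d e].
rewrite exprMn; split; first by rewrite ler_piMr.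
by split; [rewrite mulr_ile1|rewrite ler_piMl].
Qed.

Lemma on_circle0 : on_circle C0 S0.
Proof.
apply: (on_circle_poly (fun t => t * (2 - t)) (fun t => 2 - 2 * t - t ^+ 2)
  (fun t => 2 - 2 * t) (fun t => - 2 - 2 * t)).
- by move=> t; apply: der_eq; [der|rewrite /=; ring].
- by move=> t; apply: der_eq; [der|rewrite /=; ring].
- by move=> t; ring.
- by move=> t; ring.
- by move=> t; ring.
- move=> t /w_le [h _]; have E : 2 * Q t - (2 - 2 * t - t ^+ 2) = 3 * t ^+ 2 by ring.
  by rewrite E; lra.
Qed.

Lemma on_circle1 : on_circle C1 S1.
Proof.
apply: (on_circle_poly (fun t => 1 - 2 * t) (fun t => 2 * t ^+ 2 - 2 * t - 1)
  (fun t => - 2) (fun t => 4 * t - 2)).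
- by move=> t; apply: der_eq; [der|rewrite /=; ring].
- by move=> t; apply: der_eq; [der|rewrite /=; ring].
- by move=> t; ring.
- by move=> t; ring.
- by move=> t; ring.
- move=> t /w_le [_ [h _]]; have E : 2 * Q t - (2 * t ^+ 2 - 2 * t - 1) = 3 by ring.
  by rewrite E; lra.
Qed.

Lemma on_circle2 : on_circle C2 S2.
Proof.
apply: (on_circle_poly (fun t => t ^+ 2 - 1) (fun t => 4 * t - 1 - t ^+ 2)
  (fun t => 2 * t) (fun t => 4 - 2 * t)).
- by move=> t; apply: der_eq; [der|rewrite /=; ring].
- by move=> t; apply: der_eq; [der|rewrite /=; ring].
- by move=> t; ring.
- by move=> t; ring.
- by move=> t; ring.
- move=> t /w_le [_ [_ h]]; have E : 2 * Q t - (4 * t - 1 - t ^+ 2) = 3 * (1 - t) ^+ 2 by ring.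
  by rewrite E; lra.
Qed.

Let onemC0 t : 1 - C0 t = 3 * t ^+ 2 / (2 * Q t).
Proof. by rewrite /C0; field; rewrite gt_eqF. Qed.

Let onemC1 t : 1 - C1 t = 3 / (2 * Q t).
Proof. by rewrite /C1; field; rewrite gt_eqF. Qed.

Let onemC2 t : 1 - C2 t = 3 * (1 - t) ^+ 2 / (2 * Q t).
Proof. by rewrite /C2; field; rewrite gt_eqF. Qed.

Let Q2_gt0 t : 0 < 2 * Q t.
Proof. by rewrite mulr_gt0. Qed.

Let onemC0_gt0 t : 0 < t -> 0 < 1 - 1 * C0 t.
Proof. by move=> t0; rewrite mul1r onemC0 divr_gt0// mulr_gt0// exprn_gt0. Qed.

Let onemC1_gt0 t : 0 < 1 - 1 * C1 t.
Proof. by rewrite mul1r onemC1 divr_gt0. Qed.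

Let onemC2_gt0 t : t < 1 -> 0 < 1 - 1 * C2 t.
Proof. by move=> t1; rewrite mul1r onemC2 divr_gt0// mulr_gt0// exprn_gt0// subr_gt0. Qed.

Lemma clog1_re (C S : R -> R) t : (clog C S 1 t).1 = 2^-1 * ln (2 * (1 - C t)).
Proof. by rewrite /clog /=; congr (_ * ln _); rewrite expr1n; ring. Qed.

(** The quantity [2 (1 - C)] is [|1 - z|^2], which equals [3 t^2 / Q], [3 / Q] and [3 (1 - t)^2 / Q]
    at the three points; the quotients are [t^2] and [(1 - t)^2]. *)
Lemma clog_re01 t : 0 < t < 1 -> (clog C0 S0 1 t).1 - (clog C1 S1 1 t).1 = ln t.
Proof.
move=> /andP[t0 t1]; rewrite !clog1_re onemC0 onemC1.
have -> : 2 * (3 * t ^+ 2 / (2 * Q t)) = t ^+ 2 * (3 / Q t) by field; rewrite gt_eqF.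
have -> : 2 * (3 / (2 * Q t)) = 3 / Q t by field; rewrite gt_eqF.
have p0 : 0 < 3 / Q t by rewrite divr_gt0.
rewrite lnM ?posrE ?exprn_gt0// lnXn//; lra.
Qed.

Lemma clog_re21 t : 0 < t < 1 -> (clog C2 S2 1 t).1 - (clog C1 S1 1 t).1 = ln (1 - t).
Proof.
move=> /andP[t0 t1]; rewrite !clog1_re onemC2 onemC1.
have u0 : 0 < 1 - t by lra.
have -> : 2 * (3 * (1 - t) ^+ 2 / (2 * Q t)) = (1 - t) ^+ 2 * (3 / Q t) by field; rewrite gt_eqF.
have -> : 2 * (3 / (2 * Q t)) = 3 / Q t by field; rewrite gt_eqF.
have p0 : 0 < 3 / Q t by rewrite divr_gt0.
rewrite lnM ?posrE ?exprn_gt0// lnXn//; lra.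
Qed.

(** If [cos^2 = 3/4] then the triple angle has cosine 0; the bounds 0 and [pi / 4] for the angle
    keep its triple where the cosine is injective. *)
Lemma atan_sq3 : atan (sq3 / 3) = pi / 6.
Proof.
have s0 : 0 < sq3 by rewrite sqrtr_gt0.
have x2 : (sq3 / 3) ^+ 2 = 3^-1 by rewrite exprMn sq3_sqr; field.
set th := atan _.
have c2 : cos th ^+ 2 = 3 / 4.
  rewrite /th cos_atan x2 exprVn sqr_sqrtr; last by rewrite addr_ge0.
  by field.
have th0 : 0 <= th.
  rewrite -(@atan0 R); apply: le_atan; rewrite divr_ge0// ltW//.
have th1 : th <= pi / 4.
  rewrite -atan1; apply: le_atan.
  rewrite -(@ler_pXn2r _ 2)// ?nnegrE ?divr_ge0 ?ltW// x2 expr1n; lra.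
have c3 : cos (th + th + th) = 0.
  have -> : cos (th + th + th) = cos th * (cos th ^+ 2 - 3 * sin th ^+ 2).
    by rewrite !cosD sinD; ring.
  by rewrite sin2cos2 c2; rewrite (_ : _ - _ = 0) ?mulr0//; field.
have pi0 := @pi_gt0 R.
have : th + th + th = pi / 2.
  apply: cos_inj; rewrite ?cos_pihalf// in_itv /=; apply/andP; split; lra.
lra.
Qed.

Lemma eq_of_derive0 (g : R -> R) a b : a <= b ->
  (forall x, a <= x <= b -> der1 g x 0) -> g a = g b.
Proof.
move=> ab dg.
have cg : {within `[a, b], continuous g}.
  apply/continuous_in_subspaceT => x; rewrite inE /= in_itv /= => xab.
  exact: is_derive_continuous (dg x xab).
have dg' x : x \in `]a, b[%R -> is_derive x 1 g ((fun=> 0) x).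
  by rewrite in_itv /= => /andP[ax xb]; apply: dg; rewrite !ltW.
have [c _ /eqP] := MVT_segment ab dg' cg.
by rewrite mul0r subr_eq0 => /eqP ->.
Qed.

(** For [z = e^(i phi)] the argument of [1 - z] is [(phi - pi) / 2] up to a constant, so it has the
    same derivative at all three points and the differences are constant. *)
Let der_arg (C S : R -> R) t : on_circle C S -> 0 < 1 - 1 * C t ->
  der1 (fun t => (clog C S 1 t).2) t (weight t / 2).
Proof.
move=> [dC dS CS lowC] h.
have [_ d] := der_clog_t C S dC dS CS 1 t h.
apply: der_eq; first exact: d.
rewrite mul1r in h.
rewrite expr1n mul1r (_ : 1 - 2 * 1 * C t + 1 = 2 * (1 - C t)); last by ring.
by field; rewrite gt_eqF.
Qed.

(** The constant is read off at [t = 1], because [z_0 = 1] at [t = 0]. In [clog_im21] it is the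
    other end, because [z_2 = 1] at [t = 1]. *)
Lemma clog_im01 t : 0 < t < 1 -> (clog C0 S0 1 t).2 - (clog C1 S1 1 t).2 = - (pi / 3).
Proof.
move=> /andP[t0 t1].
have -> := eq_of_derive0 (fun t => (clog C0 S0 1 t).2 - (clog C1 S1 1 t).2) t 1 (ltW t1).
  have e0 : S0 1 / (1 - C0 1) = sq3 / 3 by rewrite /S0 /C0; field.
  have e1 : S1 1 / (1 - C1 1) = - (sq3 / 3) by rewrite /S1 /C1; field.
  rewrite /clog /= !mul1r e0 e1.
  by rewrite atanN atan_sq3; field.
move=> x /andP[tx x1].
have d0 := der_arg _ _ x on_circle0 (onemC0_gt0 x (lt_le_trans t0 tx)).
have d1 := der_arg _ _ x on_circle1 (onemC1_gt0 x).
by rewrite /der1; apply: der_eq; [apply: derD; [exact: d0|apply: derN; exact: d1]|rewrite subrr].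
Qed.

Lemma clog_im21 t : 0 < t < 1 -> (clog C2 S2 1 t).2 - (clog C1 S1 1 t).2 = pi / 3.
Proof.
move=> /andP[t0 t1].
have <- := eq_of_derive0 (fun t => (clog C2 S2 1 t).2 - (clog C1 S1 1 t).2) 0 t (ltW t0).
  have e0 : S2 0 / (1 - C2 0) = - (sq3 / 3) by rewrite /S2 /C2; field.
  have e1 : S1 0 / (1 - C1 0) = sq3 / 3 by rewrite /S1 /C1; field.
  rewrite /clog /= !mul1r e0 e1.
  by rewrite atanN atan_sq3; field.
move=> x /andP[x0 xt].
have d0 := der_arg _ _ x on_circle2 (onemC2_gt0 x (le_lt_trans xt t1)).
have d1 := der_arg _ _ x on_circle1 (onemC1_gt0 x).
by rewrite /der1; apply: der_eq; [apply: derD; [exact: d0|apply: derN; exact: d1]|rewrite subrr].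
Qed.

(** Built from [cadd] and [cmul], so that closure of [hol] under differences comes from the sum and
    the product. *)
Definition csub (z w : R * R) : R * R := cadd z (cmul (-1, 0) w).

Lemma csubE (z w : R * R) : csub z w = (z.1 - w.1, z.2 - w.2).
Proof. by rewrite /csub /cadd /cmul /=; congr pair; ring. Qed.

(* With [s = a + b] and [g = a b], the factors [s (9 g - 2 s^2)], [3 g - s^2]
   and [(a - b) g] are, up to constants, the elementary symmetric functions of
   degree 3 and 2 and the Vandermonde determinant of [2 a - b], [2 b - a],
   [- a - b]; the coefficients are those for which the real part in
   [cyc_poly_re] contains no mixed monomial outside [(p + q)^5]. *)
Definition cyc_poly k (a b : R * R) : R * R :=
  let s := cadd a b in let g := cmul a b in
  cmul (cmul s (csub (cmul (9, 0) g) (cmul (2, 0) (cmul s s))))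
    (cadd (cadd (cmul (- 5 * k, 0) (csub (cmul (3, 0) g) (cmul s s)))
                (cmul (0, 1) (cmul (csub a b) g)))
          (40 * k ^+ 3, 0)).

(** Passing from [t = 0] to [t = 1] permutes the three logarithms cyclically ([clog_rot]). On
    [a = l0 - l1], [b = l2 - l1] this is [(a, b) -> (- b, a - b)], which permutes [2 a - b],
    [2 b - a], [- a - b] cyclically. *)
Lemma cyc_poly_rot k (l0 l1 l2 : R * R) :
  cyc_poly k (csub l1 l2) (csub l0 l2) = cyc_poly k (csub l0 l1) (csub l2 l1).
Proof.
suff E a b : cyc_poly k (cmul (-1, 0) b) (csub a b) = cyc_poly k a b.
  rewrite -(E (csub l0 l1) (csub l2 l1)); congr cyc_poly;
  by rewrite /csub /cadd /cmul /=; congr pair; ring.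
case: a => a1 a2; case: b => b1 b2.
by rewrite /cyc_poly /csub /cadd /cmul /=; congr pair; ring.
Qed.

Lemma cyc_poly_re k p q : (cyc_poly k (p, - k) (q, k)).1 =
  k * ((p + q) ^+ 5 - 9 * (p ^+ 5 + q ^+ 5) + 90 * k ^+ 2 * (p ^+ 3 + q ^+ 3)
       + 243 * k ^+ 4 * (p + q)).
Proof. by rewrite /cyc_poly /csub /cadd /cmul /=; ring. Qed.

Lemma hol_csub (F G : R -> R -> R * R) : hol F -> hol G -> hol (fun r t => csub (F r t) (G r t)).
Proof. by move=> hF hG; apply: hol_add => //; apply: hol_mul => //; exact: hol_cst. Qed.

Lemma hol_cyc_poly k (F G : R -> R -> R * R) : hol F -> hol G ->
  hol (fun r t => cyc_poly k (F r t) (G r t)).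
Proof.
move=> hF hG; have hs := hol_add _ _ hF hG; have hg := hol_mul _ _ hF hG.
have hss := hol_mul _ _ hs hs; have hd := hol_csub _ _ hF hG.
apply: hol_mul; first apply: hol_mul => //; first apply: hol_csub.
- by apply: hol_mul => //; exact: hol_cst.
- by apply: hol_mul => //; exact: hol_cst.
- apply: hol_add; last exact: hol_cst.
  apply: hol_add; apply: hol_mul; try exact: hol_cst.
    by apply: hol_csub => //; apply: hol_mul => //; exact: hol_cst.
  exact: hol_mul.
Qed.

End ThreePoints.

(** * Evaluation of the logarithmic integral *)

Section Final.
Context {R : realType}.
Notation mu := (@lebesgue_measure R).
Implicit Types (r t x k p q : R) (n : nat).
Notation Q t := (1 - t + t ^+ 2).
Notation I f := (mu.-integrable `]0, 1[ (EFin \o f)).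

Lemma clog0 (C S : R -> R) t : clog C S 0 t = (0, 0).
Proof. by rewrite /clog !(mul0r, mulr0) expr0n /= subr0 addr0 ln1 mulr0 atan0 oppr0. Qed.

Lemma clog_rot r : [/\ clog C0 S0 r 1 = clog C1 S1 r 0 :> R * R,
  clog C1 S1 r 1 = clog C2 S2 r 0 :> R * R & clog C2 S2 r 1 = clog C0 S0 r 0 :> R * R].
Proof.
have E (C S C' S' : R -> R) : C 1 = C' 0 -> S 1 = S' 0 -> clog C S r 1 = clog C' S' r 0.
  by rewrite /clog => -> ->.
by split; apply: E; rewrite /C0 /S0 /C1 /S1 /C2 /S2; field.
Qed.

Lemma mean_value_identity k : k = pi / 3 ->
  I (fun t => (cyc_poly k (ln t, - k) (ln (1 - t), k)).1 * weight t) /\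
  \int[mu]_(t in `]0, 1[) ((cyc_poly k (ln t, - k) (ln (1 - t), k)).1 * weight t) = 0.
Proof.
move=> kE.
have [a1 a2 a3 a4] := @on_circle0 R; have h0 := hol_clog _ _ a1 a2 a3 a4.
have [b1 b2 b3 b4] := @on_circle1 R; have h1 := hol_clog _ _ b1 b2 b3 b4.
have [c1 c2 c3 c4] := @on_circle2 R; have h2 := hol_clog _ _ c1 c2 c3 c4.
pose F r t := cyc_poly k (csub (clog C0 S0 r t) (clog C1 S1 r t))
                         (csub (clog C2 S2 r t) (clog C1 S1 r t)).
have hF : hol F by apply: hol_cyc_poly; exact: hol_csub.
have per r : 0 < r < 1 -> (F r 1).2 = (F r 0).2.
  by move=> _; rewrite /F; have [-> -> ->] := clog_rot r; rewrite cyc_poly_rot.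
have F0 t : (F 0 t).1 = 0.
  have c0 (z : R * R) : cmul (0, 0) z = (0, 0) by rewrite /cmul /= !mul0r subr0 addr0.
  have s0 : cadd (0, 0) (0, 0) = (0, 0) :> R * R by rewrite /cadd /= addr0.
  have d0 : csub (0, 0) (0, 0) = (0, 0) :> R * R by rewrite csubE /= subr0.
  by rewrite /F !clog0 d0 /cyc_poly s0 !c0.
have [i e] := hol_mean F hF per F0.
have F1 t : 0 < t < 1 -> F 1 t = cyc_poly k (ln t, - k) (ln (1 - t), k).
  move=> t01; rewrite /F !csubE.
  by rewrite (clog_re01 t t01) (clog_im01 t t01) (clog_re21 t t01) (clog_im21 t t01) kE.
split.
  apply: eq_integrable i; first exact: measurable01.
  by move=> t; rewrite inE => /in01 t01; rewrite /comp F1.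
by rewrite -[RHS]e; apply: eq_Rintegral01 => t t01; rewrite F1.
Qed.

Lemma integrable_ln_quadm n : I (fun t => ln t ^+ n / Q t).
Proof.
apply: (integrable_mul _ _ (4 / 3) (integrable_ln_exp n)).
- exact: measurable_ln_expn.
- exact: measurable_inv_quadm.
- by move=> t _; exact: inv_Qm_bound.
Qed.

Lemma measurable_ln_onem1 n : measurable_fun [set: R] (fun t => ln (1 - t) ^+ n).
Proof.
apply: measurable_funX; apply: (measurableT_comp (@measurable_ln R)).
exact: measurable_funB.
Qed.

Lemma integrable_ln_onem_quadm n : I (fun t => ln (1 - t) ^+ n / Q t).
Proof.
have i1 : I (fun t => ln (1 - t) ^+ n).
  apply: (integrable_ln_bound _ 1 n).
    by apply: measurable_funTS; exact: measurable_ln_onem1.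
  move=> t t01; rewrite mul1r normrX lerXn2r ?nnegrE//.
  have /andP[w0 w4] := onem_mul_bound t t01; have /andP[t0 t1] := t01.
  have u0 : 0 < 1 - t by lra.
  have l1 : ln (1 - t) <= 0 by apply: ln_le0; lra.
  have l2 : ln (t * (1 - t)) <= 0 by apply: ln_le0; lra.
  rewrite !ler0_norm// lerN2 ler_ln ?posrE//.
  by rewrite ler_piMl ?ltW.
apply: (integrable_mul _ _ (4 / 3) i1).
- exact: measurable_ln_onem1.
- exact: measurable_inv_quadm.
- by move=> t _; exact: inv_Qm_bound.
Qed.

Lemma Rintegral_ln_onem_quadm n :
  \int[mu]_(t in `]0, 1[) (ln (1 - t) ^+ n / Q t) = \int[mu]_(t in `]0, 1[) (ln t ^+ n / Q t).
Proof.
have QE t : Q (1 - t) = Q t by ring.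
rewrite -(Rintegral01_onem (fun t => ln t ^+ n / Q t)).
- by apply: eq_Rintegral01 => t _; rewrite QE.
- apply: measurable_funM; [exact: measurable_ln_expn|exact: measurable_inv_quadm].
- rewrite (_ : (fun t => _) = (fun t => ln (1 - t) ^+ n / Q t)).
    exact: integrable_ln_onem_quadm.
  by apply/funext => t; rewrite QE.
Qed.

(** [cyc_poly_re] is solved for [(p + q)^5] with [p = ln t], [q = ln (1 - t)]. The symmetry
    [t -> 1 - t] doubles the coefficients [9], [- 90 k^2], [- 243 k^4], and [k = pi / 3] turns them
    into [18], [- 20 pi^2], [- 6 pi^4]. *)
Lemma Rintegral_ln5 :
  \int[mu]_(t in `]0, 1[) (ln (t * (1 - t)) ^+ 5 / (1 - t * (1 - t))) =
  18 * \int[mu]_(t in `]0, 1[) (ln t ^+ 5 / Q t)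
  - 20 * pi ^+ 2 * \int[mu]_(t in `]0, 1[) (ln t ^+ 3 / Q t)
  - 6 * pi ^+ 4 * \int[mu]_(t in `]0, 1[) (ln t ^+ 1 / Q t).
Proof.
pose k : R := pi / 3.
have k0 : k != 0 by rewrite mulf_neq0 ?invr_neq0// gt_eqF// pi_gt0.
have s0 : Num.sqrt 3 != 0 :> R by rewrite gt_eqF// sqrtr_gt0.
have [iZ eZ] := mean_value_identity k erefl.
pose Z t := (cyc_poly k (ln t, - k) (ln (1 - t), k)).1 * weight t.
(* Cancels the factor [k] of [cyc_poly_re] and the [sqrt 3] of [weight]. *)
pose d := (k * Num.sqrt 3)^-1.
pose J a n t := a * (ln t ^+ n / Q t + ln (1 - t) ^+ n / Q t).
have iJ a n : I (J a n).
  by apply: integrable_scale; apply: integrable_add; [exact: integrable_ln_quadm|exact: integrable_ln_onem_quadm].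
have eJ a n : \int[mu]_(t in `]0, 1[) J a n t = a * (2 * \int[mu]_(t in `]0, 1[) (ln t ^+ n / Q t)).
  rewrite Rintegral01Z; last by apply: integrable_add; [exact: integrable_ln_quadm|exact: integrable_ln_onem_quadm].
  rewrite Rintegral01D; [|exact: integrable_ln_quadm|exact: integrable_ln_onem_quadm].
  by rewrite Rintegral_ln_onem_quadm; ring.
have i0 : I (fun t => d * Z t) by exact: integrable_scale.
have i1 : I (fun t => d * Z t + J 9 5 t) by exact: integrable_add.
have i2 : I (fun t => d * Z t + J 9 5 t + J (- 90 * k ^+ 2) 3 t) by exact: integrable_add.
rewrite (eq_Rintegral01 _ (fun t => d * Z t + J 9 5 t + J (- 90 * k ^+ 2) 3 t + J (- 243 * k ^+ 4) 1 t)).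
  rewrite Rintegral01D// Rintegral01D// Rintegral01D// !eJ Rintegral01Z// eZ /k.
  by field.
move=> t /andP[t0 t1]; rewrite /Z cyc_poly_re /J /weight /d.
have -> : 1 - t * (1 - t) = Q t by ring.
rewrite lnM ?posrE ?subr_gt0//.
have q0 : Q t != 0 by rewrite gt_eqF// quadm_gt0.
by field; rewrite k0 s0 q0.
Qed.

End Final.

Theorem mainTheorem4 (R : realType) :
  cvgn (scrA_partial R 1 5) /\
  scrA R 1 5 =
    - (9 * (495 * L_chi3 R 6 - 30 * pi ^+ 2 * L_chi3 R 4
            - 2 * pi ^+ 4 * L_chi3 R 2) / 4).
Proof.
have c := @cvg_scrA_partial R 5.
split; first by apply/cvg_ex; eexists; exact: c.
(* The factors [n! (1 + 2^-n)] are [495/4], [27/4] and [3/2] for [n = 5, 3, 1]; the outer 9 is half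
   of 18. *)
rewrite /scrA (cvg_lim _ c)// Rintegral_ln5 !Rintegral_ln_quadm.
by rewrite !factS fact0 !exprS expr0; field.
Qed.
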